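(* Let $\mathsf{I}$ be a nonempty finite set, $\mathcal{X}$ a Polish space with sigma-finite reference measure $\mathrm{d}x$, and $\{\pi(i,\cdot):i\in\mathsf{I}\}$ nonnegative measurable functions on $\mathcal{X}$. Let $\pi(\mathrm{d}x)\propto\sum_{i\in\mathsf{I}}\pi(i,x)\,\mathrm{d}x$ be the corresponding mixture probability measure, with joint distribution $\bar\pi$ on $\mathsf{I}\times\mathcal{X}$, marginal weights $\pi(i)$, conditional weights $\pi(i|x)$ and components $\pi_i$. For each $i\in\mathsf{I}$ let $K_i$ be a Markov kernel on $\mathcal{X}$ that is reversible with respect to $\pi_i$ and ergodic (phi-irreducible and aperiodic), and let $$K(x,\mathrm{d}y)=\sum_{i\in\mathsf{I}}\pi(i|x)K_i(x,\mathrm{d}y).$$ Take $\|\cdot\|_\star=\|\cdot\|_{m,\pi}$ (the $L^m(\pi)$ norm) for some $m\in(2,+\infty]$. Fix $\mathsf{I}_0\subseteq\mathsf{I}$ and a family $\{\mathsf{B}_i:i\in\mathsf{I}_0\}$ of nonempty measurable subsets of $\mathcal{X}$, and set $\bar{\mathsf{B}}=\bigcup_{i\in\mathsf{I}_0}\{i\}\times\mathsf{B}_i$. Fix $\kappa>0$, and consider a graph on $\mathsf{I}_0$ such that $$\int_{\mathsf{B}_i\cap\mathsf{B}_j}\min\left(\frac{\pi_i(x)}{\pi_i(\mathsf{B}_i)},\frac{\pi_j(x)}{\pi_j(\mathsf{B}_j)}\right)\mathrm{d}x\ge\kappa$$ whenever there is an edge between $i,j\in\mathsf{I}_0$. Let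 $\mathsf{D}(\mathsf{I}_0)$ denote the diameter of this graph. Given $\zeta\in(0,1/2)$, if $\bar\pi(\bar{\mathsf{B}})\ge1-\left(\frac{\zeta}{10}\right)^{1+\frac{2}{m-2}}$, then $$\mathrm{SpecGap}_\zeta(K)\ge\frac{\kappa}{2\mathsf{D}(\mathsf{I}_0)}\ \min_{i\in\mathsf{I}_0}\left\{\pi_i(\mathsf{B}_i)^2\right\}\ \min_{i\in\mathsf{I}_0}\left\{\pi(i)\,\mathrm{SpecGap}_{\mathsf{B}_i}(K_i)\right\}.$$
   Context: Mixture notation: $\bar\pi(D\times B)=\frac{\sum_{i\in D}\int_B\pi(i,x)\mathrm{d}x}{\sum_{i\in\mathsf{I}}\int_{\mathcal{X}}\pi(i,x)\mathrm{d}x}$ for $D\subseteq\mathsf{I}$ and $B$ measurable; $\pi(i)\propto\int_{\mathcal{X}}\pi(i,x)\mathrm{d}x$ is the marginal probability of $i$; $\pi(i|x)\propto\pi(i,x)$ is the conditional probability of $i$ given $x$; $\pi_i(\mathrm{d}x)\propto\pi(i,x)\mathrm{d}x$ is the conditional probability measure on $\mathcal{X}$ given $i$, whose density is also written $\pi_i(x)$ (each $\int_{\mathcal{X}} \pi(i,x)\mathrm{d}x$ is in $(0,\infty)$ so that these are defined). The kernel $K$ is reversible with respect to $\pi$. The norm: $\|f\|_{m,\pi}=(\int|f|^m\mathrm{d}\pi)^{1/m}$ for $m<\infty$, and the $\pi$-essential supremum of $|f|$ for $m=+\infty$ (then $\frac{2}{m-2}=0$). With $\mathrm{Var}_\pi(f)=\int(f-\int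 f\mathrm{d}\pi)^2\mathrm{d}\pi$ and $\mathcal{E}(f,f)=\frac12\int\int(f(y)-f(x))^2\pi(\mathrm{d}x)K(x,\mathrm{d}y)$, the $\zeta$-spectral gap is $$\mathrm{SpecGap}_\zeta(K)=\inf\left\{\frac{\mathcal{E}(f,f)}{\mathrm{Var}_\pi(f)-\frac{\zeta}{2}}:\ f\in L^2(\pi),\ \mathrm{Var}_\pi(f)>\zeta,\ \|f\|_\star=1\right\}.$$ Restricted spectral gap: for a Markov kernel $P$ reversible with respect to a probability measure $\mu$ and a measurable set $\mathcal{X}_0$ with $\mu(\mathcal{X}_0)>0$, $$\mathrm{SpecGap}_{\mathcal{X}_0}(P)=\inf_f\frac{\int_{\mathcal{X}_0}\int_{\mathcal{X}_0}\mu(\mathrm{d}x)P(x,\mathrm{d}y)(f(y)-f(x))^2}{\int_{\mathcal{X}_0}\int_{\mathcal{X}_0}\mu(\mathrm{d}x)\mu(\mathrm{d}y)(f(y)-f(x))^2},$$ the infimum being over measurable $f:\mathcal{X}\to\mathbb{R}$ for which the denominator is $>0$. In $\mathrm{SpecGap}_{\mathsf{B}_i}(K_i)$ one uses $\mu=\pi_i$. Infima over empty classes are $+\infty$. The diameter of a graph is the number of edges in the longest among all shortest paths between pairs of vertices; the bound is read in the case where it is meaningful, $1\le\mathsf{D}(\mathsf{I}_0)<\infty$ (and $\pi_i(\mathsf{B}_i)>0$ for $i\in\mathsf{I}_0$). *)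

(* Defs.v *)
From HB Require Import structures.
From mathcomp Require Import all_boot all_order all_algebra.
From mathcomp Require Import all_classical all_reals all_analysis.
From mathcomp Require Import measurable_realfun.

Set Implicit Arguments.
Unset Strict Implicit.
Unset Printing Implicit Defensive.

Import Order.TTheory GRing.Theory Num.Theory.
Import numFieldNormedType.Exports.

Local Open Scope classical_set_scope.
Local Open Scope ring_scope.
Local Open Scope ereal_scope.

Section polish.
Context (R : realType) (T : topologicalType).
Local Open Scope ring_scope.

Definition complete_compatible_metric (dist : T -> T -> R) : Prop :=
  [/\ forall x y, dist x y = 0 <-> x = y,
      forall x y, dist x y = dist y x,
      forall x y z, dist x z <= dist x y + dist y z,
      forall (x : T) (A : set T), nbhs x A <->
        exists2 e : R, 0 < e & [set y | dist x y < e] `<=` A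
    & forall u : nat -> T,
        (forall e : R, 0 < e -> exists N, forall m n,
           (N <= m)%N -> (N <= n)%N -> dist (u m) (u n) < e) ->
        exists l : T, u @ \oo --> l].

Definition polish : Prop :=
  (exists2 D : set T, countable D & dense D) /\
  (exists dist : T -> T -> R, complete_compatible_metric dist).

End polish.

Definition borel (T : ptopologicalType) := g_sigma_algebraType (@open T).
HB.instance Definition _ (T : ptopologicalType) := Measurable.on (borel T).

Section density.
Context d (X : measurableType d) (R : realType).
Variable mu : {measure set X -> \bar R}.

Definition mass (f : X -> R) : \bar R := \int[mu]_x (f x)%:E.

Record normalizable (f : X -> R) : Prop := Normalizable {
  normalizable_measurable : measurable_fun [set: X] f;
  normalizable_ge0 : forall x, (0 <= f x)%R;
  normalizable_mass_gt0 : 0 < mass f;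
  normalizable_mass_lty : mass f < +oo }.

Definition density_prob (f : X -> R) (hf : normalizable f) (A : set X) : \bar R :=
  (\int[mu]_(x in A) (f x)%:E) / mass f.

Section instances.
Variables (f : X -> R) (hf : normalizable f).

Let mf : measurable_fun [set: X] (fun x => (f x)%:E).
Proof. by apply/measurable_EFinP; case: hf. Qed.

Let massE : exists2 r : R, (0 < r)%R & mass f = r%:E.
Proof.
case: hf => _ _; case: (mass f) => [m|//|//]; rewrite lte_fin => m0 _.
by exists m.
Qed.

Let massV : exists2 r : R, (0 < r)%R & (mass f)^-1 = r%:E.
Proof.
case: massE => m m0 ->; exists (m^-1)%R; first by rewrite invr_gt0.
by rewrite /inve gt_eqF.
Qed.

Let density_prob0 : density_prob hf set0 = 0.
Proof. by rewrite /density_prob integral_set0 mul0e. Qed.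

Let density_prob_ge0 A : 0 <= density_prob hf A.
Proof.
case: massV => r r0 rE; rewrite /density_prob rE mule_ge0//.
  by apply: integral_ge0 => x _; rewrite lee_fin (normalizable_ge0 hf).
by rewrite lee_fin ltW.
Qed.

Let density_prob_sigma_additive : semi_sigma_additive (density_prob hf).
Proof.
move=> F mF tF mUF; rewrite /density_prob.
have f0 x : 0 <= (f x)%:E by rewrite lee_fin (normalizable_ge0 hf).
rewrite ge0_integral_bigcup//; last exact: measurable_funTS.
case: massV => r r0 rE; rewrite rE.
rewrite (_ : (fun n => _) = fun n =>
    (\sum_(0 <= i < n) \int[mu]_(x in F i) (f x)%:E) * r%:E); last first.
  by apply/funext => n; rewrite ge0_sume_distrl// => i _; exact: integral_ge0.
by apply: cvgeZr => //; apply: is_cvg_ereal_nneg_natsum => i _; exact: integral_ge0.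
Qed.

HB.instance Definition _ := isMeasure.Build _ _ _ (density_prob hf)
  density_prob0 density_prob_ge0 density_prob_sigma_additive.

Let density_probT : density_prob hf setT = 1.
Proof.
case: massE => m m0 mE; rewrite /density_prob -/(mass f) mE /inve gt_eqF//.
by rewrite -EFinM divff// gt_eqF.
Qed.

HB.instance Definition _ :=
  Measure_isProbability.Build _ _ _ (density_prob hf) density_probT.

End instances.
End density.

Section markov.
Context d (X : measurableType d) (R : realType).

Definition reversible (mu : probability X R) (P : R.-pker X ~> X) : Prop :=
  forall A B, measurable A -> measurable B ->
    \int[mu]_(x in A) P x B = \int[mu]_(x in B) P x A.

Fixpoint kernel_iter (P : R.-pker X ~> X) (n : nat) (x : X) (A : set X) : \bar R :=
  if n is n'.+1 then \int[P x]_y kernel_iter P n' y A else \d_x A.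

Definition phi_irreducible (P : R.-pker X ~> X) : Prop :=
  exists2 phi : {sigma_finite_measure set X -> \bar R}, phi [set: X] != 0 &
    forall A, measurable A -> 0 < phi A ->
      forall x, exists2 n, (0 < n)%N & 0 < kernel_iter P n x A.

(* No cycle C_0 -> C_1 -> ... -> C_n -> C_0 of length n + 1 >= 2 made of
   disjoint sets carries positive stationary mass. *)
Definition aperiodic (mu : probability X R) (P : R.-pker X ~> X) : Prop :=
  ~ exists n : nat, exists C : 'I_n.+1 -> set X,
    [/\ (0 < n)%N, forall i, measurable (C i), trivIset [set: 'I_n.+1] C,
        forall i x, C i x -> P x (C (ordS i)) = 1
      & 0 < mu (C ord0)].

Definition ergodic (mu : probability X R) (P : R.-pker X ~> X) : Prop :=
  phi_irreducible P /\ aperiodic mu P.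

Definition dirichlet_form (mu : probability X R) (P : R.-pker X ~> X)
    (f : X -> R) : \bar R :=
  2^-1%:E * \int[mu]_x \int[P x]_y ((f y - f x) ^+ 2)%:E.

Definition spec_gap_zeta (star : (X -> R) -> \bar R) (zeta : R)
    (mu : probability X R) (P : R.-pker X ~> X) : \bar R :=
  ereal_inf [set dirichlet_form mu P f / ('V_mu[f] - (zeta / 2)%:E) | f in
    [set f : X -> R | [/\ f \in Lfun mu 2%:E, zeta%:E < 'V_mu[f] & star f = 1]]].

(* [Q = P] gives the numerator and [Q = fun=> mu] the denominator of the
   quotient defining the restricted spectral gap. *)
Definition local_form (X0 : set X) (mu : probability X R)
    (Q : X -> {measure set X -> \bar R}) (f : X -> R) : \bar R :=
  \int[mu]_(x in X0) \int[Q x]_(y in X0) ((f y - f x) ^+ 2)%:E.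

(* The quotient is only formed when the denominator is finite: in [\bar R],
   [+oo / +oo] evaluates to [0]. By truncation, an [f] with a finite
   numerator and an infinite denominator would not change the infimum. *)
Definition spec_gap_on (X0 : set X) (mu : probability X R)
    (P : R.-pker X ~> X) : \bar R :=
  ereal_inf [set local_form X0 mu P f / local_form X0 mu (fun=> mu) f | f in
    [set f : X -> R | measurable_fun [set: X] f /\
                      0 < local_form X0 mu (fun=> mu) f < +oo]].

End markov.

Section kernel_mixture.
Context d (X : measurableType d) (R : realType) (I : finType).

Record weights (w : I -> X -> R) : Prop := Weights {
  weights_measurable : forall i, measurable_fun [set: X] (w i);
  weights_ge0 : forall i x, (0 <= w i x)%R;
  weights_sum1 : forall x, (\sum_i w i x)%R = 1%R }.

Definition kernel_mixture (w : I -> X -> R) (hw : weights w)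
    (K_ : I -> R.-pker X ~> X) (x : X) (A : set X) : \bar R :=
  \sum_i (w i x)%:E * K_ i x A.

Section instances.
Variables (w : I -> X -> R) (hw : weights w) (K_ : I -> R.-pker X ~> X).

Section measure.
Variable x : X.

Let kernel_mixture0 : kernel_mixture hw K_ x set0 = 0.
Proof. by rewrite /kernel_mixture big1// => i _; rewrite measure0 mule0. Qed.

Let kernel_mixture_ge0 A : 0 <= kernel_mixture hw K_ x A.
Proof.
by apply: sume_ge0 => i _; rewrite mule_ge0// lee_fin (weights_ge0 hw).
Qed.

Let kernel_mixture_sigma_additive : semi_sigma_additive (kernel_mixture hw K_ x).
Proof.
move=> F mF tF mUF; rewrite /kernel_mixture.
under eq_fun do rewrite exchange_big/=.
apply: cvg_nnesum => i _.
  apply: nearW => n; apply: sume_ge0 => k _.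
  by rewrite mule_ge0// lee_fin (weights_ge0 hw).
rewrite (_ : (fun n => _) = fun n =>
    (w i x)%:E * \sum_(0 <= k < n) K_ i x (F k)); last first.
  by apply/funext => n; rewrite ge0_sume_distrr.
by apply: cvgeZl => //; exact: measure_semi_sigma_additive.
Qed.

HB.instance Definition _ := isMeasure.Build _ _ _ (kernel_mixture hw K_ x)
  kernel_mixture0 kernel_mixture_ge0 kernel_mixture_sigma_additive.

End measure.

Definition mixture_kernel : X -> {measure set X -> \bar R} :=
  kernel_mixture hw K_.

Let measurable_mixture_kernel U : measurable U ->
  measurable_fun [set: X] (mixture_kernel ^~ U).
Proof.
move=> mU; apply: emeasurable_sum => i.
apply: emeasurable_funM; last exact: measurable_kernel.
by apply/measurable_EFinP; exact: weights_measurable.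
Qed.

HB.instance Definition _ :=
  isKernel.Build _ _ _ _ _ mixture_kernel measurable_mixture_kernel.

Let mixture_kernelT x : mixture_kernel x [set: X] = 1.
Proof.
rewrite /mixture_kernel/= /kernel_mixture.
under eq_bigr do rewrite prob_kernel mule1.
by rewrite sumEFin (weights_sum1 hw).
Qed.

HB.instance Definition _ :=
  Kernel_isProbability.Build _ _ _ _ _ mixture_kernel mixture_kernelT.

End instances.
End kernel_mixture.

Section mixture.
Context d (X : measurableType d) (R : realType) (I : finType).
Variables (mu : {measure set X -> \bar R}) (p : I -> X -> R).

Definition total (x : X) : R := (\sum_i p i x)%R.

Definition joint_prob (C : set (I * X)) : \bar R :=
  (\sum_i \int[mu]_(x in xsection C i) (p i x)%:E) / (\sum_i mass mu (p i)).

Definition index_prob (i : I) : \bar R :=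
  mass mu (p i) / (\sum_j mass mu (p j)).

(* [pi(i | x)] is arbitrary where [total x = 0], a [pi]-null set; uniform
   weights there make the mixture of kernels a Markov kernel everywhere. *)
Definition cond_index (i : I) (x : X) : R :=
  if total x == 0%R then (#|I|%:R^-1)%R else (p i x / total x)%R.

Definition component_density (i : I) (x : X) : R :=
  (p i x / fine (mass mu (p i)))%R.

Hypothesis I_gt0 : (0 < #|I|)%N.
Hypothesis hp : forall i, normalizable mu (p i).

Definition component (i : I) : probability X R := density_prob (hp i).

Let p_ge0 i x : (0 <= p i x)%R.
Proof. exact: normalizable_ge0 (hp i) x. Qed.

Let mp i : measurable_fun [set: X] (p i).
Proof. exact: normalizable_measurable (hp i). Qed.

Lemma measurable_total : measurable_fun [set: X] total.
Proof. exact: measurable_sum. Qed.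

Lemma mass_total : mass mu total = \sum_i mass mu (p i).
Proof.
rewrite /mass /total; under eq_integral do rewrite -sumEFin.
rewrite ge0_integral_sum// => [i|i x _]; last by rewrite lee_fin.
exact/measurable_EFinP.
Qed.

Lemma normalizable_total : normalizable mu total.
Proof.
split; first exact: measurable_total.
- by move=> x; apply: sumr_ge0.
- have /card_gt0P[i0 _] := I_gt0.
  rewrite mass_total (bigD1 i0)//=; apply: lte_paddr.
    by apply: sume_ge0 => i _; apply: integral_ge0 => x _; rewrite lee_fin.
  exact: normalizable_mass_gt0.
- rewrite mass_total; apply: lte_sum_pinfty => i _.
  exact: normalizable_mass_lty.
Qed.

Definition mixture : probability X R := density_prob normalizable_total.

Lemma weights_cond_index : weights cond_index.
Proof.
have nI : (#|I|%:R : R) != 0%R by rewrite pnatr_eq0 -lt0n.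
have mc : measurable_fun [set: X] (fun x => total x == 0%R).
  by apply: measurable_fun_eqr => //; exact: measurable_total.
split.
- move=> i; apply: measurable_fun_ifT => //.
  have invE : (fun x => (total x)^-1)%R = (fun x => total x `^ (-1))%R.
    by apply/funext => x; rewrite powR_inv1// sumr_ge0.
  apply: measurable_funM => //; rewrite invE.
  have H := (measurableT_comp (measurable_powR (-1)%R) measurable_total).
  exact: H.
- move=> i x; rewrite /cond_index; case: ifP => _; rewrite ?invr_ge0//.
  by rewrite divr_ge0// sumr_ge0.
- move=> x; rewrite /cond_index; case: (eqVneq (total x) 0%R) => [_|t0].
    by rewrite sumr_const -(mulr_natl (_^-1)%R) mulfV.
  by rewrite -mulr_suml divff.
Qed.

Definition mixture_of_kernels (K_ : I -> R.-pker X ~> X) : R.-pker X ~> X :=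
  mixture_kernel weights_cond_index K_.

End mixture.

Section graph.
Variable I : finType.

Record simple_graph_on (I0 : {set I}) (e : rel I) : Prop := SimpleGraphOn {
  graph_sub : forall i j, e i j -> (i \in I0) && (j \in I0);
  graph_sym : symmetric e;
  graph_irr : irreflexive e }.

(* [+oo] when no walk joins [i] to [j], so that [diameter] is [+oo] on a
   disconnected graph. *)
Definition graph_dist (R : realType) (e : rel I) (i j : I) : \bar R :=
  ereal_inf [set (size s)%:R%:E | s in [set s : seq I | path e i s /\ last i s = j]].

Definition diameter (R : realType) (I0 : {set I}) (e : rel I) : \bar R :=
  ereal_sup [set graph_dist R e ij.1 ij.2 |
             ij in [set ij : I * I | (ij.1 \in I0) && (ij.2 \in I0)]].

End graph.

Definition tail_exponent (R : realType) (m : \bar R) : R :=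
  (1 + if m is r%:E then 2 / (r - 2) else 0)%R.

(* Main.v *)
Require Import Defs.
From HB Require Import structures.
From mathcomp Require Import all_boot all_order all_algebra.
From mathcomp Require Import all_classical all_reals all_analysis.
From mathcomp Require Import measurable_realfun ess_sup_inf.
From mathcomp Require Import ring lra.
Import Order.TTheory GRing.Theory Num.Theory.
Import numFieldNormedType.Exports.
Local Open Scope classical_set_scope.
Local Open Scope ring_scope.
Local Open Scope ereal_scope.

(* Let m_i and v_i be the mean and variance of f under pi_i conditioned on B_i.
   On the cylinder set the Dirichlet form of the mixture dominates
   sum_i pi(i) SpecGap_{B_i}(K_i) pi_i(B_i)^2 v_i, so it suffices to bound
   Var(f) - zeta/2 by (2 D / kappa) sum_i v_i.  Replacing the mean of f by its
   mean c over the cylinder set only increases the variance integral.  Off the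
   cylinder set (f - c)^2 <= 2 f^2 + 2 c^2 and Hoelder's inequality leave at most
   zeta/2.  On it there remain the v_i and the spread of the m_i.  An overlap of
   mass kappa forces kappa (m_i - m_j)^2 <= 2 (v_i + v_j) along each edge, and
   Cauchy-Schwarz along shortest paths bounds all pairs.  Each inner vertex of a
   path lies on two of its edges and each endpoint on one; the endpoint terms
   thus saved pay for the v_i themselves because kappa <= 1 <= D. *)

Set Implicit Arguments.
Unset Strict Implicit.
Unset Printing Implicit Defensive.

(** * Means and variances over a finite graph *)

Section weighted_sums.
Local Open Scope ring_scope.
Context (R : realFieldType) (I : finType) (P : pred I) (a m : I -> R).

Let A := \sum_(i | P i) a i.
Let c := (\sum_(i | P i) a i * m i) / A.

Lemma sum_sqr_dev_mean (A_neq0 : A != 0) :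
  \sum_(i | P i) a i * (m i - c) ^+ 2 =
  \sum_(i | P i) a i * m i ^+ 2 - A * c ^+ 2.
Proof.
have -> : \sum_(i | P i) a i * (m i - c) ^+ 2 =
    \sum_(i | P i) a i * m i ^+ 2 - 2 * c * (\sum_(i | P i) a i * m i)
      + A * c ^+ 2.
  rewrite /A mulr_sumr mulr_suml -sumrB -big_split/=.
  by apply: eq_bigr => i _; ring.
by rewrite -(divfK A_neq0 (\sum_(i | P i) a i * m i)) -/c; ring.
Qed.

(** A weighted variance is half the weighted mean of the squared differences over all pairs;
    unnormalized weights give the factor [2 * A]. This reduces the spread of the means to bounds on
    pairs. *)
Lemma sum_sqr_dev_pairs (A_neq0 : A != 0) :
  2 * A * (\sum_(i | P i) a i * (m i - c) ^+ 2) =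
  \sum_(i | P i) \sum_(j | P j) a i * a j * (m i - m j) ^+ 2.
Proof.
rewrite sum_sqr_dev_mean//.
set s2 := \sum_(i | P i) a i * m i ^+ 2.
have E i : \sum_(j | P j) a i * a j * (m i - m j) ^+ 2 =
    A * (a i * m i ^+ 2) - (2 * A * c) * (a i * m i) + s2 * a i.
  rewrite -[2 * A * c]mulrA.
  have -> : A * c = \sum_(i | P i) a i * m i by rewrite mulrC divfK.
  rewrite /A /s2 mulr_suml mulr_sumr !mulr_suml -sumrB -big_split/=.
  by apply: eq_bigr => j _; ring.
under eq_bigr do rewrite E.
rewrite big_split/= sumrB -!mulr_sumr -/s2 -/A.
have -> : \sum_(i | P i) a i * m i = A * c by rewrite mulrC divfK.
ring.
Qed.

End weighted_sums.

(** * Differences of means along a walk *)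

Section canonical_path.
Local Open Scope ring_scope.
Context (R : realFieldType) (I : finType) (m v : I -> R) (kappa : R).
Hypothesis v_ge0 : forall i, 0 <= v i.

(** The last factor on the right is the sum of [v a + v b] over the edges of the walk, and
    Cauchy-Schwarz costs their number [size s]. The bound in this form passes through the induction
    on the walk. *)
Lemma path_sqr_dev (e : rel I) (s : seq I) (i : I) :
  (forall a b, e a b -> kappa * (m a - m b) ^+ 2 <= 2 * (v a + v b)) ->
  0 < kappa -> path e i s ->
  kappa * (m i - m (last i s)) ^+ 2 <=
  2 * (size s)%:R * (2 * (\sum_(k <- i :: s) v k) - v i - v (last i s)).
Proof.
move=> edge k0; elim: s i => [|j s IH] i /=.
  by rewrite subrr expr0n/= !mulr0 mul0r.
move=> /andP[eij pjs]; have := IH _ pjs.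
rewrite !big_cons; set S := \sum_(k <- s) v k; set z := last j s => H.
have := edge _ _ eij.
set n := (size s)%:R : R in H *.
have n0 : 0 <= n by rewrite /n.
rewrite -[(size s).+1%:R]natr1 -/n => Hij.
have vi := v_ge0 i; have vj := v_ge0 j.
(* The edge sum of the remaining walk is nonnegative; the one-edge case below uses it. *)
have V : 0 <= 2 * (v j + S) - v j - v z.
  have : v z <= \sum_(k <- j :: s) v k.
    by rewrite (big_rem _ (mem_last j s))/= lerDl sumr_ge0.
  rewrite big_cons -/S.
  have : 0 <= S by apply: sumr_ge0.
  lra.
set y := 2 * (v j + S) - v j - v z in H V.
have -> : 2 * (n + 1) * (2 * (v i + (v j + S)) - v i - v z) =
  2 * (n + 1) * ((v i + v j) + y) by rewrite /y; ring.
(* Cauchy-Schwarz with the weights 1 and n; n = 0 is the one-edge path. *)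
have [nz|nz] := eqVneq n 0.
  have : kappa * (m j - m z) ^+ 2 <= 0.
    by move: H; rewrite nz mulr0 mul0r.
  rewrite pmulr_rle0// => h.
  have /eqP : (m j - m z) ^+ 2 = 0 by apply/eqP; rewrite eq_le h sqr_ge0.
  rewrite sqrf_eq0 subr_eq0 => /eqP <-; rewrite nz; nra.
have np : 0 < n by rewrite lt_def nz.
rewrite -(ler_pM2l np).
set p := m i - m j in Hij *; set q := m j - m z in H *.
have -> : m i - m z = p + q by rewrite /p /q; ring.
have CS : n * (p + q) ^+ 2 <= (n + 1) * (n * p ^+ 2 + q ^+ 2).
  rewrite -subr_ge0.
  have -> : (n + 1) * (n * p ^+ 2 + q ^+ 2) - n * (p + q) ^+ 2 = (n * p - q) ^+ 2.
    by ring.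
  exact: sqr_ge0.
apply: (@le_trans _ _ (kappa * ((n + 1) * (n * p ^+ 2 + q ^+ 2)))).
  by rewrite mulrCA ler_pM2l.
have -> : kappa * ((n + 1) * (n * p ^+ 2 + q ^+ 2)) =
  (n + 1) * (n * (kappa * p ^+ 2) + kappa * q ^+ 2) by ring.
have -> : n * (2 * (n + 1) * (v i + v j + y)) =
  (n + 1) * (n * (2 * (v i + v j)) + 2 * n * y) by ring.
by rewrite ler_pM2l ?ltr_wpDl// lerD// ler_wpM2l.
Qed.

End canonical_path.

(** * Shortest walks and the diameter *)

Section graph_diameter.
Context (R : realType) (I : finType) (I0 : {set I}) (e : rel I).

(** A finite infimum over lengths of walks is attained by a walk of minimal length. Removing cycles
    makes its vertices distinct without lengthening it, so that sums along the walk count no vertex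
    twice. *)
Lemma graph_dist_path (i j : I) : graph_dist R e i j < +oo ->
  exists s : seq I, [/\ path e i s, last i s = j, uniq (i :: s) &
    (size s)%:R%:E <= graph_dist R e i j].
Proof.
rewrite /graph_dist => /ereal_inf_lt [_ [s0 [ps0 ls0] <-] _].
have ex : exists n, `[< exists s : seq I, [/\ path e i s, last i s = j & size s = n] >].
  by exists (size s0); apply/asboolP; exists s0.
case: (ex_minnP ex) => n /asboolP[s [ps ls sn]] nmin.
case/shortenP: ps ls => s' ps' us' ss' ls'.
exists s'; split => //.
apply: le_ereal_inf_tmp => _ [t [pt lt'] <-]; rewrite lee_fin ler_nat.
apply: (@leq_trans n); last by apply: nmin; apply/asboolP; exists t.
rewrite -sn; apply: uniq_leq_size => //.
by move: us' => /= /andP[].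
Qed.

Lemma graph_dist_diameter (i j : I) : i \in I0 -> j \in I0 ->
  graph_dist R e i j <= diameter R I0 e.
Proof.
by move=> iI jI; apply: ereal_sup_ubound; exists (i, j) => //=; rewrite iI.
Qed.

(** Some pair is at positive distance, so a walk joining it is nonempty and starts with an edge.
    That edge supplies an element of [I0] and, through the overlap, [kappa <= 1]. *)
Lemma diameter_edge : 1 <= diameter R I0 e -> diameter R I0 e < +oo ->
  exists i j, e i j.
Proof.
move=> D1 Doo; have : 0 < diameter R I0 e by exact: lt_le_trans D1.
move=> /ereal_sup_gt[_ [[i j] /= /andP[iI jI] <-]] dij.
have [s [ps ls us _]] := graph_dist_path (le_lt_trans (graph_dist_diameter iI jI) Doo).
case: s ps ls us => [_ /= ij _|k s /= /andP[eik _] _ _]; last by exists i, k.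
exfalso; move: dij; rewrite ltNge => /negP; apply.
by apply: ereal_inf_lbound; exists [::].
Qed.

End graph_diameter.

(** * A Poincaré inequality with the diameter as constant *)

Section poincare.
Context (R : realType) (I : finType) (I0 : {set I}) (e : rel I).
Hypothesis graph_e : simple_graph_on I0 e.

(** Averaging the pair bound [2 * D * (2 * S - v i - v j)] with the weights [a i * a j] bounds the
    spread of the means by [2 * D * (A * S - V)], where [V] is the weighted sum of the [v i]. The
    term [- 2 * D * V] absorbs [kappa * V], and [A <= 1] removes [A]. *)
Lemma diameter_poincare (m v a : I -> R) (kappa D : R) :
  (forall i, 0 <= v i)%R -> (forall i, 0 <= a i)%R ->
  (0 < \sum_(i in I0) a i <= 1)%R -> (0 < kappa <= 1)%R -> (1 <= D)%R ->
  diameter R I0 e = D%:E ->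
  (forall i j, e i j -> kappa * (m i - m j) ^+ 2 <= 2 * (v i + v j))%R ->
  forall c, c = ((\sum_(i in I0) a i * m i) / \sum_(i in I0) a i)%R ->
  (kappa * \sum_(i in I0) a i * (v i + (m i - c) ^+ 2) <=
   2 * D * \sum_(i in I0) v i)%R.
Proof.
move=> v0 a0 /andP[A0 A1] /andP[k0 k1] D1 DE edge _ ->.
set A := (\sum_(i in I0) a i)%R in A0 A1 *;
set c := (_ / A)%R; set S := (\sum_(i in I0) v i)%R.
have Dge0 : (0 <= D)%R by exact: le_trans D1.
have pair i j : i \in I0 -> j \in I0 ->
    (kappa * (m i - m j) ^+ 2 <= 2 * D * (2 * S - v i - v j))%R.
  move=> iI jI; have dD := graph_dist_diameter R e iI jI.
  have doo : graph_dist R e i j < +oo by rewrite (le_lt_trans dD)// DE ltry.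
  have [s [ps ls us sD]] := graph_dist_path doo.
  have sD' : ((size s)%:R <= D)%R by rewrite -lee_fin -DE (le_trans sD).
  have := @path_sqr_dev R I m v kappa v0 e s i edge k0 ps.
  rewrite ls => /le_trans; apply.
  have ss : {subset i :: s <= I0}.
    move=> x; rewrite inE => /predU1P[->//|].
    elim: s i {iI dD doo ls us sD sD'} ps => [//|y s IH] i /= /andP[eiy py].
    have /andP[_ yI] := graph_sub graph_e eiy.
    by rewrite inE => /predU1P[->//|]; exact: IH py.
  (* The vertices are distinct and lie in [I0], so the sum along the walk is a part of [S]. *)
  have SS : (\sum_(k <- i :: s) v k <= S)%R.
    rewrite big_uniq//= /S (big_setID [set k in i :: s])/=.
    rewrite (_ : (\sum_(k in I0 :&: [set k in i :: s]) v k =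
       \sum_(k in i :: s) v k)%R); last first.
      apply: eq_bigl => k; rewrite !inE andb_idl// => ki; apply: ss.
      by rewrite inE.
    by rewrite lerDl sumr_ge0.
  have jl : j \in i :: s by rewrite -ls mem_last.
  (* Nonnegativity allows the bound on the length and the bound on the sum to be multiplied. *)
  have V0 : (0 <= 2 * (\sum_(k <- i :: s) v k) - v i - v j)%R.
    have : (v j <= \sum_(k <- i :: s) v k)%R.
      by rewrite (big_rem _ jl)/= lerDl sumr_ge0.
    have : (v i <= \sum_(k <- i :: s) v k)%R.
      by rewrite big_cons lerDl sumr_ge0.
    lra.
  apply: ler_pM => //.
    by rewrite ler_pM2l.
  by rewrite !lerD2r ler_pM2l.
have An : (A != 0)%R by rewrite gt_eqF.
have SE : (\sum_(i in I0) a i * (v i + (m i - c) ^+ 2) =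
    \sum_(i in I0) a i * v i + \sum_(i in I0) a i * (m i - c) ^+ 2)%R.
  by rewrite -big_split; apply: eq_bigr => i _; rewrite /= mulrDr.
have key : (kappa * \sum_(i in I0) a i * (m i - c) ^+ 2 <=
    2 * D * (A * S - \sum_(i in I0) a i * v i))%R.
  have A2 : (0 < 2 * A)%R by rewrite mulr_gt0.
  (* Multiplying both sides by [2 * A] brings in the identity over pairs. *)
  rewrite -(ler_pM2l A2) mulrCA (sum_sqr_dev_pairs _ An) mulr_sumr.
  set V := (\sum_(i in I0) a i * v i)%R.
  have -> : (2 * A * (2 * D * (A * S - V)) =
      \sum_(i in I0) \sum_(j in I0) a i * a j * (2 * D * (2 * S - v i - v j)))%R.
    have E i : (\sum_(j in I0) a i * a j * (2 * D * (2 * S - v i - v j)) =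
        4 * D * S * A * a i - 2 * D * A * (a i * v i) - 2 * D * V * a i)%R.
      rewrite /A /V (mulr_sumr _ _ _ (4 * D * S)%R) (mulr_sumr _ _ _ (2 * D)%R).
      rewrite (mulr_sumr _ _ _ (2 * D)%R) !mulr_suml -!sumrB.
      by apply: eq_bigr => j _; ring.
    under eq_bigr do rewrite E.
    by rewrite !sumrB -!mulr_sumr -/A -/V; ring.
  apply: ler_sum => i iI; rewrite mulr_sumr; apply: ler_sum => j jI.
  by rewrite mulrCA ler_wpM2l ?mulr_ge0// pair.
have S0 : (0 <= S)%R by apply: sumr_ge0.
have V0 : (0 <= \sum_(i in I0) a i * v i)%R.
  by apply: sumr_ge0 => i _; rewrite mulr_ge0.
rewrite SE mulrDr; move: key V0; set V := (\sum_(i in I0) a i * v i)%R => key V0.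
have : (2 * D * (A * S) <= 2 * D * S)%R.
  by rewrite ler_wpM2l ?mulr_ge0// ler_piMl.
have : (kappa * V <= 2 * D * V)%R.
  rewrite ler_wpM2r//; lra.
move: key; rewrite mulrBr; lra.
Qed.

End poincare.

(** * Integrals against densities and mixtures *)

Lemma inve_EFin (R : realFieldType) (r : R) : (0 < r)%R ->
  (r%:E)^-1 = (r^-1)%:E.
Proof. by move=> r0; rewrite /inve gt_eqF. Qed.

Section integral_density.
Context d (T : measurableType d) (R : realType).
Variables (mu nu : {measure set T -> \bar R}) (q : T -> R).
Hypotheses (q_ge0 : forall x, (0 <= q x)%R) (mq : measurable_fun [set: T] q).
Hypothesis nuE : forall A, measurable A -> nu A = \int[mu]_(x in A) (q x)%:E.

Import HBNNSimple.

Let mEq : measurable_fun [set: T] (fun x => (q x)%:E).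
Proof. exact/measurable_EFinP. Qed.

Let integral_density_indic (A : set T) : measurable A ->
  \int[nu]_x (\1_A x)%:E = \int[mu]_x ((\1_A x)%:E * (q x)%:E).
Proof.
move=> mA; rewrite integral_indic// setIT nuE// [LHS]integral_mkcond.
by apply: eq_integral => x _; rewrite muleC epatch_indic.
Qed.

Let integral_density_nnsfun (h : {nnsfun T >-> R}) :
  \int[nu]_x (h x)%:E = \int[mu]_x ((h x)%:E * (q x)%:E).
Proof.
have hq r x : 0 <= (r * \1_(h @^-1` [set r]) x)%:E by exact: nnfun_muleindic_ge0.
have mh r : measurable_fun [set: T] (fun x => (r * \1_(h @^-1` [set r]) x)%:E).
  by apply/measurable_EFinP; exact: measurable_funM.
under eq_integral do rewrite fimfunE -fsumEFin//.
rewrite ge0_integral_fsum//.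
under [RHS]eq_integral.
  move=> x _; rewrite fimfunE -fsumEFin// ge0_mule_fsuml//; over.
rewrite ge0_integral_fsum//; last 2 first.
  - by move=> r; exact: emeasurable_funM.
  - by move=> r x _; rewrite mule_ge0// lee_fin.
apply: eq_fsbigr => r; rewrite inE => -[t _ htr].
have r0 : (0 <= r)%R by rewrite -htr.
under eq_integral do rewrite EFinM.
under [RHS]eq_integral do rewrite EFinM -muleA.
rewrite !ge0_integralZl//; first by rewrite integral_density_indic.
- by apply: emeasurable_funM => //; exact/measurable_EFinP.
- by move=> x _; rewrite mule_ge0// lee_fin.
- exact/measurable_EFinP.
Qed.

(** Change of measure for [nu = q mu]: known for indicators and simple functions, it passes to [f]
    by monotone convergence along [nnsfun_approx]. *)
Lemma ge0_integral_density (f : T -> \bar R) : (forall x, 0 <= f x) ->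
  measurable_fun [set: T] f -> \int[nu]_x f x = \int[mu]_x (f x * (q x)%:E).
Proof.
move=> f0 mf; pose h := nnsfun_approx measurableT mf.
have hf x : (h n x)%:E @[n --> \oo] --> f x by exact: cvg_nnsfun_approx.
have hnd x : {homo (fun n => (h n x)%:E) : a b / (a <= b)%N >-> a <= b}.
  by move=> a b ab; rewrite lee_fin; exact/lefP/nd_nnsfun_approx.
have mh n : measurable_fun [set: T] (fun x => (h n x)%:E).
  exact/measurable_EFinP.
under eq_integral do rewrite -(cvg_lim _ (hf _))//.
rewrite monotone_convergence//; last by move=> n x _; rewrite lee_fin.
under [RHS]eq_integral.
  move=> x _; rewrite -(cvg_lim _ (cvgeZr (y := (q x)%:E) _ (hf x)))//; over.
rewrite monotone_convergence//.
- by under eq_fun do rewrite integral_density_nnsfun.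
- by move=> n; exact: emeasurable_funM.
- by move=> n x _; rewrite mule_ge0// lee_fin.
- move=> x _ a b ab; apply: lee_wpmul2r; rewrite ?lee_fin//.
  exact/lefP/nd_nnsfun_approx.
Qed.

Lemma ge0_integral_density_in (E : set T) (f : T -> \bar R) : measurable E ->
  (forall x, 0 <= f x) -> measurable_fun [set: T] f ->
  \int[nu]_(x in E) f x = \int[mu]_(x in E) (f x * (q x)%:E).
Proof.
move=> mE f0 mf; rewrite integral_mkcond ge0_integral_density.
- rewrite [RHS]integral_mkcond; apply: eq_integral => x _.
  by rewrite !patchE; case: ifP => //; rewrite mul0e.
- by move=> x; rewrite patchE; case: ifP.
- by apply/(measurable_restrictT _ mE); exact: measurable_funTS.
Qed.

End integral_density.

Section integral_kernel_mixture.
Context d (T : measurableType d) (R : realType) (I : finType).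
Context (w : I -> T -> R) (hw : weights w) (K_ : I -> R.-pker T ~> T).

Lemma ge0_integral_mixture_kernel (x : T) (f : T -> \bar R) :
  (forall y, 0 <= f y) -> measurable_fun [set: T] f ->
  \int[mixture_kernel hw K_ x]_y f y = \sum_i (w i x)%:E * \int[K_ i x]_y f y.
Proof.
move=> f0 mf.
pose wn i : {nonneg R} := NngNum (weights_ge0 hw i x).
(* [msum] takes measures indexed by [nat], so [I] is enumerated; the zero measure fills the indices
   from [#|I|] on, where the sum has stopped. *)
pose m_ (n : nat) : {measure set T -> \bar R} :=
  if insub n is Some k then mscale (wn (enum_val (k : 'I_#|I|))) (K_ (enum_val k) x)
  else mzero.
rewrite (eq_measure_integral (msum m_ #|I|)); last first.
  move=> A mA _; rewrite /msum /= /kernel_mixture.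
  rewrite (reindex (fun k : 'I_#|I| => enum_val k))/=; last first.
    exact/onW_bij/enum_val_bij.
  by apply: eq_bigr => k _; rewrite /m_ valK.
rewrite ge0_integral_measure_sum//.
rewrite [RHS](reindex (fun k : 'I_#|I| => enum_val k))/=; last first.
  exact/onW_bij/enum_val_bij.
by apply: eq_bigr => k _; rewrite /m_ valK ge0_integral_mscale.
Qed.

End integral_kernel_mixture.

(** * Bayes' rule and disintegration of the mixture *)

Section mixture_integral.
Context d (X : measurableType d) (R : realType) (I : finType).
Variables (mu : {measure set X -> \bar R}) (p : I -> X -> R).
Hypothesis I_gt0 : (0 < #|I|)%N.
Hypothesis hp : forall i, normalizable mu (p i).

Let ms i := fine (mass mu (p i)).
Let Z := (\sum_i ms i)%R.

Let ms_gt0 i : (0 < ms i)%R.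
Proof.
by rewrite fine_gt0// (normalizable_mass_gt0 (hp i)) (normalizable_mass_lty (hp i)).
Qed.

Let massE i : mass mu (p i) = (ms i)%:E.
Proof.
by rewrite fineK// ge0_fin_numE ?(normalizable_mass_lty (hp i))//
  ltW// (normalizable_mass_gt0 (hp i)).
Qed.

Let sum_massE : \sum_i mass mu (p i) = Z%:E.
Proof. by under eq_bigr do rewrite massE; rewrite sumEFin. Qed.

Let Z_gt0 : (0 < Z)%R.
Proof.
have /card_gt0P[i0 _] := I_gt0.
by rewrite /Z (bigD1 i0)//= ltr_pwDl// sumr_ge0// => i _; exact: ltW.
Qed.

Let mp i : measurable_fun [set: X] (p i).
Proof. exact: normalizable_measurable (hp i). Qed.

Let p0 i x : (0 <= p i x)%R.
Proof. exact: normalizable_ge0 (hp i) x. Qed.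

Definition index_weight i : R := fine (index_prob mu p i).

Let weightE i : index_weight i = (ms i / Z)%R.
Proof. by rewrite /index_weight /index_prob sum_massE massE inve_EFin. Qed.

Lemma index_probE i : index_prob mu p i = (index_weight i)%:E.
Proof. by rewrite weightE /index_prob sum_massE massE inve_EFin. Qed.

Lemma index_weight_gt0 i : (0 < index_weight i)%R.
Proof. by rewrite weightE divr_gt0. Qed.

Lemma index_weight_sum1 : (\sum_i index_weight i = 1)%R.
Proof.
under eq_bigr do rewrite weightE.
by rewrite -mulr_suml divff// gt_eqF.
Qed.

Lemma component_density_ge0 i x : (0 <= component_density mu p i x)%R.
Proof. by rewrite divr_ge0// ltW// ms_gt0. Qed.

Lemma measurable_component_density i :
  measurable_fun [set: X] (component_density mu p i).
Proof. exact: measurable_funM. Qed.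

Lemma component_densityE i A : measurable A ->
  component hp i A = \int[mu]_(x in A) (component_density mu p i x)%:E.
Proof.
move=> mA; rewrite /component /= /density_prob massE inve_EFin//.
rewrite /component_density; under [RHS]eq_integral do rewrite EFinM.
rewrite ge0_integralZr//.
- exact/measurable_EFinP/measurable_funTS.
- by move=> x _; rewrite lee_fin.
- by rewrite lee_fin invr_ge0; exact/ltW/ms_gt0.
Qed.

Lemma mixture_densityE A : measurable A ->
  mixture I_gt0 hp A = \int[mu]_(x in A) (Defs.total p x / Z)%:E.
Proof.
move=> mA; rewrite /mixture /= /density_prob mass_total// sum_massE inve_EFin//.
under [RHS]eq_integral do rewrite EFinM.
rewrite ge0_integralZr//.
- by apply/measurable_EFinP/measurable_funTS; exact: measurable_total hp.
- by move=> x _; rewrite lee_fin sumr_ge0.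
- by rewrite lee_fin invr_ge0 ltW.
Qed.

(** Bayes' rule for densities. At a zero of the total density every [p i x] vanishes, and both sides
    are 0. *)
Let cond_index_totalE i x :
  (cond_index p i x * (Defs.total p x / Z) =
   index_weight i * component_density mu p i x)%R.
Proof.
rewrite weightE /component_density -/(ms i) /cond_index.
have msn : ms i != 0%R by rewrite gt_eqF.
have Zn : Z != 0%R by rewrite gt_eqF.
case: eqVneq => [t0|tn]; last by field; rewrite tn msn Zn.
have -> : p i x = 0%R.
  have /eqP := t0; rewrite psumr_eq0// => /allP/(_ i).
  by rewrite mem_index_enum => /(_ isT)/eqP.
by rewrite t0 !(mul0r, mulr0).
Qed.

(** Disintegration of the joint law: drawing [x] and then [i] given [x] amounts to drawing [i] and
    then [x] given [i]. Both sides become integrals against [mu], where Bayes' rule matches them. *)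
Lemma integral_mixture_cond (g : I -> X -> \bar R) :
  (forall i x, 0 <= g i x) -> (forall i, measurable_fun [set: X] (g i)) ->
  \int[mixture I_gt0 hp]_x (\sum_i (cond_index p i x)%:E * g i x) =
  \sum_i index_prob mu p i * \int[component hp i]_x g i x.
Proof.
move=> g0 mg; have [mw w0 _] := weights_cond_index I_gt0 hp.
have mden i : measurable_fun [set: X] (EFin \o component_density mu p i).
  exact/measurable_EFinP/measurable_component_density.
rewrite (ge0_integral_density (mu := mu)
  (q := fun x => (Defs.total p x / Z)%R)); first last.
- apply: emeasurable_sum => i; apply: emeasurable_funM => //.
  exact/measurable_EFinP.
- by move=> x; apply: sume_ge0 => i _; rewrite mule_ge0// lee_fin.
- by move=> A mA; exact: mixture_densityE.
- by apply: measurable_funM => //; exact: measurable_total hp.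
- by move=> x; rewrite divr_ge0 ?(ltW Z_gt0)// sumr_ge0.
have E x : (\sum_i (cond_index p i x)%:E * g i x) * (Defs.total p x / Z)%:E =
    \sum_i (index_weight i)%:E * (g i x * (component_density mu p i x)%:E).
  rewrite ge0_sume_distrl; last by move=> i _; rewrite mule_ge0// lee_fin.
  apply: eq_bigr => i _.
  by rewrite muleAC -EFinM cond_index_totalE EFinM muleA muleAC.
under eq_integral do rewrite E.
rewrite ge0_integral_sum//; last 2 first.
- move=> i; apply: emeasurable_funM => //.
  by apply: emeasurable_funM => //; exact: mden.
- move=> i x _; rewrite !mule_ge0// lee_fin ?component_density_ge0//.
  exact/ltW/index_weight_gt0.
apply: eq_bigr => i _; rewrite ge0_integralZl//; last 3 first.
- by apply: emeasurable_funM => //; exact: mden.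
- by move=> x _; rewrite mule_ge0// lee_fin component_density_ge0.
- by rewrite lee_fin; exact/ltW/index_weight_gt0.
rewrite index_probE (ge0_integral_density (nu := component hp i) (mu := mu)
  (q := component_density mu p i))//.
- by move=> x; exact: component_density_ge0.
- exact: measurable_component_density.
- by move=> A mA; exact: component_densityE.
Qed.

Lemma integral_mixture (g : X -> \bar R) :
  (forall x, 0 <= g x) -> measurable_fun [set: X] g ->
  \int[mixture I_gt0 hp]_x g x =
  \sum_i index_prob mu p i * \int[component hp i]_x g x.
Proof.
move=> g0 mg; have [_ w0 w1] := weights_cond_index I_gt0 hp.
rewrite -integral_mixture_cond//; apply: eq_integral => x _.
rewrite -ge0_sume_distrl; last by move=> i _; rewrite lee_fin.
by rewrite sumEFin w1 mul1e.
Qed.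

(** The section of the union at [i] is [B i] for [i] in [I0] and empty otherwise. *)
Lemma joint_prob_cylinders (I0 : {set I}) (B : I -> set X) :
  joint_prob mu p (\bigcup_(i in [set` I0]) ([set i] `*` B i)) =
  \sum_(i in I0) index_prob mu p i * component hp i (B i).
Proof.
rewrite /joint_prob sum_massE inve_EFin// ge0_sume_distrl; last first.
  by move=> i _; apply: integral_ge0 => x _; rewrite lee_fin.
rewrite [RHS]big_mkcond/=; apply: eq_bigr => i _.
case: ifPn => iI.
  have -> : xsection (\bigcup_(i in [set` I0]) ([set i] `*` B i)) i = B i.
    apply/seteqP; split => [x|x Bx]; rewrite /xsection/= inE.
      by move=> [j _ [/= -> ]].
    by exists i.
  rewrite index_probE weightE /component /= /density_prob massE inve_EFin//.
  rewrite muleCA; congr (_ * _); rewrite -EFinM.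
  by rewrite mulrAC divff ?mul1r// gt_eqF.
have -> : xsection (\bigcup_(i in [set` I0]) ([set i] `*` B i)) i = set0.
  apply/seteqP; split => [x|x//]; rewrite /xsection/= inE => -[j /= jI [/= ij _]].
  by move: iI; rewrite ij jI.
by rewrite integral_set0 mul0e.
Qed.

End mixture_integral.

(** * Local means and variances *)

Section local_moments.
Context d (T : measurableType d) (R : realType) (Q : probability T R).
Variables (B : set T) (mB : measurable B) (f : T -> R).
Hypotheses (mf : measurable_fun [set: T] f).
Hypothesis if2 : Q.-integrable [set: T] (fun x => (f x ^+ 2)%:E).
Hypothesis B0 : 0 < Q B.
Local Open Scope ring_scope.

Let b := fine (Q B).

Definition local_mean := (\int[Q]_(x in B) f x) / b.
Definition local_var := (\int[Q]_(x in B) (f x - local_mean) ^+ 2) / b.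

Let b_gt0 : 0 < b.
Proof. by rewrite fine_gt0// B0 ltey_eq fin_num_measure. Qed.

Lemma local_var_ge0 : 0 <= local_var.
Proof. by rewrite divr_ge0 ?(ltW b_gt0)// Rintegral_ge0// => x _; exact: sqr_ge0. Qed.

(** [|f| <= 1 + f^2], and constants are integrable for a probability. *)
Lemma integrable_of_sqr : Q.-integrable [set: T] (EFin \o f).
Proof.
have i1 : Q.-integrable [set: T] (EFin \o (fun x => 1 + f x ^+ 2)).
  rewrite /comp; under eq_fun do rewrite EFinD.
  by apply: integrableD => //; exact: finite_measure_integrable_cst.
apply: (le_integrable _ _ _ i1) => //; first exact/measurable_EFinP.
move=> x _; rewrite /= lee_fin [leRHS]ger0_norm ?addr_ge0 ?sqr_ge0//.
by rewrite ler_norml; apply/andP; split; nra.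
Qed.

Let ifB : Q.-integrable B (EFin \o f).
Proof. by apply: (integrableS measurableT) => //; exact: integrable_of_sqr. Qed.

Let if2B : Q.-integrable B (EFin \o (fun x => f x ^+ 2)).
Proof. exact: (integrableS measurableT). Qed.

Let icB c : Q.-integrable B (EFin \o (fun x : T => c)).
Proof. by have := @finite_measure_integrable_cst _ _ _ Q B c mB. Qed.

Let sqr_shiftE c : (fun x => (f x - c) ^+ 2) =
  (fun x => f x ^+ 2 + (- (2 * c) * f x + c ^+ 2)).
Proof. by apply/funext => x; ring. Qed.

Let i2B c : Q.-integrable B (EFin \o (fun x => - (2 * c) * f x + c ^+ 2)).
Proof.
rewrite /comp; under eq_fun do rewrite EFinD.
apply: integrableD => //; last exact: icB.
by under eq_fun do rewrite EFinM; exact: integrableZl.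
Qed.

Lemma integrable_sqr_shift c :
  Q.-integrable B (EFin \o (fun x => (f x - c) ^+ 2)).
Proof.
rewrite sqr_shiftE.
rewrite /comp; under eq_fun do rewrite EFinD.
by apply: integrableD => //; exact: i2B.
Qed.

Let Rintegral_sqr_shift0 c : \int[Q]_(x in B) (f x - c) ^+ 2 =
  \int[Q]_(x in B) (f x ^+ 2) - 2 * c * (b * local_mean) + c ^+ 2 * b.
Proof.
rewrite sqr_shiftE RintegralD// RintegralD//; last first.
  rewrite /comp; under eq_fun do rewrite EFinM.
  exact: integrableZl.
have -> : b * local_mean = \int[Q]_(x in B) f x.
  by rewrite /local_mean mulrC divfK ?gt_eqF.
rewrite RintegralZl// Rintegral_cst// -/b; ring.
Qed.

(** Bias-variance decomposition under [Q] conditioned on [B], multiplied by the mass [b]. The local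
    mean as [c] gives the variance, and [c = 0] the second moment. *)
Lemma integral_sqr_shift c : (\int[Q]_(x in B) ((f x - c) ^+ 2)%:E)%E =
  (b * (local_var + (local_mean - c) ^+ 2))%:E.
Proof.
rewrite -[LHS]fineK; last exact: integrable_fin_num (integrable_sqr_shift c).
congr EFin; rewrite -/(Rintegral _ _ _) mulrDr /local_var.
rewrite [b * (_ / b)]mulrC divfK ?gt_eqF// !Rintegral_sqr_shift0.
ring.
Qed.

(** The decomposition is applied twice: in [y] with [c = f x], then in [x] with [c] the local mean.
    Each time a variance weighted by [b ^+ 2] appears. *)
Lemma local_form_prob :
  local_form B Q (fun=> Q) f = (2 * b ^+ 2 * local_var)%:E.
Proof.
rewrite /local_form.
under eq_integral do rewrite integral_sqr_shift mulrDr EFinD.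
have mvar : measurable_fun B (fun x => (b * (local_mean - f x) ^+ 2)%:E).
  apply/measurable_EFinP/measurable_funM => //; apply: measurable_funX.
  by apply: measurable_funB => //; exact: measurable_funTS.
rewrite ge0_integralD//=; last 2 first.
- by move=> x _; rewrite lee_fin mulr_ge0 ?(ltW b_gt0)// local_var_ge0.
- by move=> x _; rewrite lee_fin mulr_ge0 ?(ltW b_gt0)// sqr_ge0.
rewrite integral_cst//= -[Q B]fineK ?fin_num_measure// -/b.
under eq_integral do rewrite EFinM.
rewrite ge0_integralZl//; last 3 first.
- apply/measurable_EFinP; apply: measurable_funX.
  by apply: measurable_funB => //; exact: measurable_funTS.
- by move=> x _; rewrite lee_fin sqr_ge0.
- by rewrite lee_fin ltW.
under eq_integral do rewrite -[(local_mean - _)%R]opprB sqrrN.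
rewrite integral_sqr_shift -!EFinM -EFinD; congr EFin.
rewrite subrr; ring.
Qed.

End local_moments.

(** * Comparison of two local means through the overlap *)

Section overlap.
Context d (T : measurableType d) (R : realType).
Variables (mu : {measure set T -> \bar R}) (f : T -> R).
Hypothesis mf : measurable_fun [set: T] f.

Section one_component.
Variables (Q : probability T R) (q : T -> R) (B : set T).
Hypotheses (q_ge0 : forall x, (0 <= q x)%R) (mq : measurable_fun [set: T] q).
Hypothesis QE : forall A, measurable A -> Q A = \int[mu]_(x in A) (q x)%:E.
Hypotheses (mB : measurable B) (B0 : 0 < Q B).

Let b := fine (Q B).
Let b_gt0 : (0 < b)%R.
Proof. by rewrite fine_gt0// B0 ltey_eq fin_num_measure. Qed.

Lemma dens_divE x : (q x)%:E / Q B = (q x / b)%:E.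
Proof. by rewrite -[Q B]fineK ?fin_num_measure// -/b inve_EFin. Qed.

Lemma integral_dens_div (C : set T) : measurable C -> C `<=` B ->
  \int[mu]_(x in C) ((q x)%:E / Q B) <= 1.
Proof.
move=> mC CB; under eq_integral do rewrite dens_divE EFinM.
rewrite ge0_integralZr//; last 3 first.
- exact/measurable_EFinP/measurable_funTS.
- by move=> x _; rewrite lee_fin.
- by rewrite lee_fin invr_ge0 ltW.
rewrite -QE// lee_pdivrMr// mul1e /b fineK ?fin_num_measure//.
by apply: le_measure; rewrite ?inE.
Qed.

(** Equality holds for [C = B], and a smaller set only lowers the integral of a nonnegative
    function. *)
Lemma integral_dens_div_sqr (C : set T) :
  Q.-integrable [set: T] (fun x => (f x ^+ 2)%:E) ->
  measurable C -> C `<=` B ->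
  \int[mu]_(x in C) ((q x)%:E / Q B * ((f x - local_mean Q B f) ^+ 2)%:E) <=
  (local_var Q B f)%:E.
Proof.
move=> if2 mC CB; set m := local_mean Q B f.
have mfm : measurable_fun [set: T] (fun x => ((f x - m) ^+ 2)%:E).
  by apply/measurable_EFinP/measurable_funX; exact: measurable_funB.
have mfq : measurable_fun [set: T] (fun x => ((f x - m) ^+ 2)%:E * (q x)%:E).
  by apply: emeasurable_funM => //; exact/measurable_EFinP.
under eq_integral do rewrite dens_divE EFinM muleC muleA.
rewrite ge0_integralZr//; last 3 first.
- exact: measurable_funTS.
- by move=> x _; rewrite mule_ge0 ?lee_fin ?sqr_ge0.
- by rewrite lee_fin invr_ge0 ltW.
rewrite lee_pdivrMr//.
have -> : (local_var Q B f)%:E * b%:E =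
    \int[mu]_(x in B) (((f x - m) ^+ 2)%:E * (q x)%:E).
  rewrite -(ge0_integral_density_in (nu := Q))//; last first.
    by move=> x; rewrite lee_fin sqr_ge0.
  rewrite integral_sqr_shift// subrr expr0n addr0.
  by rewrite -EFinM mulrC.
apply: ge0_subset_integral => //; first exact: measurable_funTS.
by move=> x _; rewrite mule_ge0 ?lee_fin ?sqr_ge0.
Qed.

End one_component.

Section two_components.
Variables (Q Q' : probability T R) (q q' : T -> R) (B B' : set T).
Hypotheses (q_ge0 : forall x, (0 <= q x)%R) (mq : measurable_fun [set: T] q).
Hypotheses (q'_ge0 : forall x, (0 <= q' x)%R) (mq' : measurable_fun [set: T] q').
Hypothesis QE : forall A, measurable A -> Q A = \int[mu]_(x in A) (q x)%:E.
Hypothesis Q'E : forall A, measurable A -> Q' A = \int[mu]_(x in A) (q' x)%:E.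
Hypotheses (mB : measurable B) (B0 : 0 < Q B).
Hypotheses (mB' : measurable B') (B'0 : 0 < Q' B').
Variable kappa : R.
Hypothesis overlap : kappa%:E <=
  \int[mu]_(x in B `&` B') mine ((q x)%:E / Q B) ((q' x)%:E / Q' B').

Let mBB' : measurable (B `&` B'). Proof. exact: measurableI. Qed.

Let divB_ge0 x : 0 <= (q x)%:E / Q B.
Proof. by rewrite dens_divE// lee_fin divr_ge0 ?fine_ge0. Qed.

Let divB'_ge0 x : 0 <= (q' x)%:E / Q' B'.
Proof. by rewrite dens_divE// lee_fin divr_ge0 ?fine_ge0. Qed.

Let mdivB : measurable_fun [set: T] (fun x => (q x)%:E / Q B).
Proof.
by under eq_fun do rewrite dens_divE//; exact/measurable_EFinP/measurable_funM.
Qed.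

Let mdivB' : measurable_fun [set: T] (fun x => (q' x)%:E / Q' B').
Proof.
by under eq_fun do rewrite dens_divE//; exact/measurable_EFinP/measurable_funM.
Qed.

Let min_ge0 x : 0 <= mine ((q x)%:E / Q B) ((q' x)%:E / Q' B').
Proof. by rewrite le_min divB_ge0 divB'_ge0. Qed.

Let mmin : measurable_fun [set: T]
  (fun x => mine ((q x)%:E / Q B) ((q' x)%:E / Q' B')).
Proof. exact: measurable_mine. Qed.

(** The minimum is below the first conditional density, whose mass is at most 1. *)
Lemma overlap_le1 : (kappa <= 1)%R.
Proof.
rewrite -lee_fin (le_trans overlap)//.
apply: (le_trans _ (integral_dens_div q_ge0 mq QE mB B0 mBB' (@subIsetl _ _ _))).
apply: ge0_le_integral => //; try exact: measurable_funTS.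
by move=> x _; rewrite ge_min lexx.
Qed.

Hypothesis if2 : Q.-integrable [set: T] (fun x => (f x ^+ 2)%:E).
Hypothesis if2' : Q'.-integrable [set: T] (fun x => (f x ^+ 2)%:E).

Let m := local_mean Q B f.
Let m' := local_mean Q' B' f.

(** The pointwise bound [(m - m')^2 <= 2 (f - m)^2 + 2 (f - m')^2] is integrated against the minimum
    of the two conditional densities; in each term the minimum is then replaced by the density
    belonging to that mean. *)
Lemma overlap_local_mean :
  (kappa * (m - m') ^+ 2 <= 2 * (local_var Q B f + local_var Q' B' f))%R.
Proof.
have mfm c : measurable_fun [set: T] (fun x => ((f x - c) ^+ 2)%:E).
  by apply/measurable_EFinP/measurable_funX; exact: measurable_funB.
have sqr0 c x : 0 <= ((f x - c) ^+ 2)%:E by rewrite lee_fin sqr_ge0.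
rewrite -lee_fin EFinM [leRHS]EFinM.
apply: (@le_trans _ _ (\int[mu]_(x in B `&` B')
    (mine ((q x)%:E / Q B) ((q' x)%:E / Q' B') * ((m - m') ^+ 2)%:E))).
  rewrite ge0_integralZr//; last 2 first.
  - exact: measurable_funTS.
  - by rewrite lee_fin sqr_ge0.
  by rewrite lee_wpmul2r// lee_fin sqr_ge0.
apply: (@le_trans _ _ (\int[mu]_(x in B `&` B')
   (2%:E * ((q x)%:E / Q B * ((f x - m) ^+ 2)%:E +
            (q' x)%:E / Q' B' * ((f x - m') ^+ 2)%:E)))).
  apply: ge0_le_integral => //.
  - by move=> x _; rewrite mule_ge0// lee_fin sqr_ge0.
  - by apply: measurable_funTS; apply: emeasurable_funM.
  - apply: measurable_funTS; apply: emeasurable_funM => //.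
    by apply: emeasurable_funD; exact: emeasurable_funM.
  - move=> x _; rewrite !dens_divE// -EFin_min -!EFinM lee_fin.
    set u := (q x / _)%R; set u' := (q' x / _)%R.
    have u0 : (0 <= u)%R by rewrite divr_ge0 ?fine_ge0.
    have u'0 : (0 <= u')%R by rewrite divr_ge0 ?fine_ge0.
    set y := Num.min u u'.
    have y0 : (0 <= y)%R by rewrite le_min u0.
    have yu : (y <= u)%R by rewrite ge_min lexx.
    have yu' : (y <= u')%R by rewrite ge_min lexx orbT.
    apply: (@le_trans _ _ (2 * (y * (f x - m) ^+ 2 + y * (f x - m') ^+ 2))%R).
      rewrite -mulrDr [leRHS]mulrCA; apply: ler_wpM2l => //; rewrite -subr_ge0.
      (* The slack of the pointwise bound is a perfect square. *)
      have -> : (2 * ((f x - m) ^+ 2 + (f x - m') ^+ 2) - (m - m') ^+ 2 =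
        (2 * f x - m - m') ^+ 2)%R by ring.
      exact: sqr_ge0.
    by rewrite ler_pM2l// lerD// ler_wpM2r// sqr_ge0.
rewrite ge0_integralZl//; last 2 first.
- by apply: measurable_funTS; apply: emeasurable_funD; exact: emeasurable_funM.
- by move=> x _; apply: adde_ge0; apply: mule_ge0.
rewrite lee_pmul2l// ge0_integralD//; last 4 first.
- by move=> x _; rewrite mule_ge0.
- by apply: measurable_funTS; exact: emeasurable_funM.
- by move=> x _; rewrite mule_ge0.
- by apply: measurable_funTS; exact: emeasurable_funM.
by rewrite EFinD; apply: leeD; apply: integral_dens_div_sqr.
Qed.

End two_components.
End overlap.

(** * Localizing the variance *)

Section weighted_square.
Context d (T : measurableType d) (R : realType) (P : probability T R).
Variables (f h : T -> R) (m : \bar R).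
Hypotheses (mf : measurable_fun [set: T] f) (mh : measurable_fun [set: T] h).
Hypothesis h01 : forall x, (0 <= h x <= 1)%R.
Hypotheses (m_gt2 : 2%:E < m) (f1 : 'N[P]_m[EFin \o f] = 1).

Let h0 x : (0 <= h x)%R. Proof. by case/andP: (h01 x). Qed.
Let h1 x : (h x <= 1)%R. Proof. by case/andP: (h01 x). Qed.

(** Hölder's inequality for [f ^+ 2] and [h] with exponents [m / 2] and [m / (m - 2)], the latter
    being [tail_exponent m]. The first factor is 1 by normalization, and [h^q <= h] as [h] is in
    [[0, 1]] and [q >= 1]. For [m = +oo], [f ^+ 2 <= 1] almost everywhere. *)
Lemma hoelder_weighted_square :
  \int[P]_x (f x ^+ 2 * h x)%:E <=
  (\int[P]_x (h x)%:E) `^ (tail_exponent m)^-1.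
Proof.
have mfh : measurable_fun [set: T] (fun x => (f x ^+ 2 * h x)%:E).
  by apply/measurable_EFinP/measurable_funM => //; exact: measurable_funX.
have mh' : measurable_fun [set: T] (EFin \o h) by exact/measurable_EFinP.
case: m m_gt2 f1 => [r|_|//]; rewrite /tail_exponent.
- rewrite lte_fin => r2 fr.
  have r0 : (0 < r)%R by lra.
  pose q := (1 + 2 / (r - 2))%R.
  have q1 : (1 <= q)%R by rewrite lerDl divr_ge0//; lra.
  have q0 : (0 < q)%R by exact: lt_le_trans q1.
  have pq : ((r / 2)^-1 + q^-1 = 1)%R.
    have r2n : (r - 2 != 0)%R by apply: lt0r_neq0; lra.
    have -> : (q = r / (r - 2))%R by rewrite /q; field.
    by rewrite !invf_div -mulrDl addrC subrK divff// gt_eqF.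
  have mf2 : measurable_fun [set: T] (fun x => f x ^+ 2)%R.
    exact: measurable_funX.
  have r20 : (0 < r / 2)%R by rewrite divr_gt0.
  have := @hoelder _ _ _ P (fun x => f x ^+ 2)%R h (r / 2)%R q mf2 mh
    r20 q0 pq.
  rewrite Lnorm1 (eq_integral (fun x => (f x ^+ 2 * h x)%:E)); last first.
    by move=> x _; rewrite /= ger0_norm// mulr_ge0 ?sqr_ge0.
  move=> /le_trans; apply.
  (* The [r / 2] norm of [f ^+ 2] is the square of the [r] norm of [f]. *)
  have -> : 'N[P]_(r / 2)%:E[EFin \o (fun x => f x ^+ 2)%R] = 1.
    rewrite unlock /=.
    under eq_integral.
      move=> x _; rewrite ger0_norm ?sqr_ge0// -real_normK ?num_real//.
      rewrite -powR_mulrn// -powRrM mulrC divfK//.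
      over.
    have := @powR_Lnorm _ _ _ P (EFin \o f) r; rewrite gt_eqF// => /(_ isT).
    by rewrite fr poweR1r /= => <-; rewrite poweR1r.
  rewrite mul1e unlock /=.
  apply: gt0_ler_poweR => //.
  - by rewrite invr_ge0 ltW.
  - by rewrite in_itv/= leey andbT integral_ge0.
  - by rewrite in_itv/= leey andbT integral_ge0// => x _; rewrite lee_fin.
  - apply: ge0_le_integral => //.
    + apply/measurable_EFinP/(measurableT_comp (measurable_powR _)).
      exact: measurableT_comp.
    + move=> x _; rewrite lee_fin ger0_norm//.
      have [->|hx0] := eqVneq (h x) 0%R; first by rewrite powR0 ?gt_eqF.
      by apply: ge1r_powR => //; rewrite h1 andbT lt_def hx0 h0.
 - move=> fy; rewrite addr0 invr1 poweRe1; last first.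
    by apply: integral_ge0 => x _; rewrite lee_fin.
  (* The norm at [+oo] unfolds to the essential supremum because [P] has positive total mass. *)
  have fle : \forall x \ae P, `|f x|%:E <= 1.
    have := ess_sup_ge P (abse \o (EFin \o f)).
    by move: fy; rewrite unlock /= probability_setT lte01 => ->.
  apply: ae_ge0_le_integral => //.
  + by move=> x _; rewrite lee_fin mulr_ge0// sqr_ge0.
  + by move=> x _; rewrite lee_fin.
  + apply: filterS fle => x; rewrite !lee_fin => fx _.
    rewrite ler_piMl// -real_normK ?num_real//.
    by rewrite expr_le1.
Qed.

End weighted_square.

Section variance_localization.
Context d (T : measurableType d) (R : realType) (P : probability T R).
Variable f : T -> R.
Hypothesis fL2 : f \in Lfun P 2%:E.

Let mf : measurable_fun [set: T] f.
Proof. by move: fL2; rewrite inE => /andP[]; rewrite inE. Qed.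

Let if2 : P.-integrable [set: T] (fun x => (f x ^+ 2)%:E).
Proof. exact: Lfun2_integrable_sqr. Qed.

(** The mean minimizes the mean squared deviation; this is the bias-variance decomposition on the
    whole space. *)
Lemma variance_le_sqr_shift c : 'V_P[f] <= \int[P]_x ((f x - c) ^+ 2)%:E.
Proof.
have PT : fine (P [set: T]) = 1%R by rewrite probability_setT.
have PT0 : 0 < P [set: T] by rewrite probability_setT.
have mE : local_mean P [set: T] f = fine 'E_P[f].
  by rewrite /local_mean PT divr1 unlock.
have -> : 'V_P[f] = \int[P]_x ((f x - local_mean P [set: T] f) ^+ 2)%:E.
  rewrite mE /variance covariance.unlock; move: (fine 'E_P[f]) => a.
  by rewrite unlock; apply: eq_integral => x _; rewrite expr2.
rewrite !(integral_sqr_shift measurableT mf if2 PT0) PT !mul1r lee_fin.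
by rewrite subrr expr0n addr0 lerDl sqr_ge0.
Qed.

(* [k x] plays the role of the conditional probability, given [x], of the
   cylinder set formed by the B_i. *)
Variables (k : T -> R) (m : \bar R) (zeta A c : R).
Hypotheses (mk : measurable_fun [set: T] k) (k01 : forall x, (0 <= k x <= 1)%R).
Hypotheses (m_gt2 : 2%:E < m) (f1 : 'N[P]_m[EFin \o f] = 1).
Hypotheses (zeta_gt0 : (0 < zeta)%R) (zeta_lt : (zeta < 1 / 2)%R).

Let te_ge1 : (1 <= tail_exponent m)%R.
Proof.
rewrite /tail_exponent lerDl; case: m m_gt2 => [r|//|//].
by rewrite lte_fin => r2; rewrite divr_ge0// subr_ge0 ltW.
Qed.

Let z01 : (0 < zeta / 10 <= 1)%R.
Proof. by move: zeta_gt0 zeta_lt => z0 z1; apply/andP; split; lra. Qed.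

Let powR_te_inv (a : R) : (0 <= a)%R -> (a <= (zeta / 10) `^ tail_exponent m)%R ->
  (a `^ (tail_exponent m)^-1 <= zeta / 10)%R.
Proof.
move=> a0 az; have te0 : (0 < tail_exponent m)%R by exact: lt_le_trans te_ge1.
have z0 : (0 <= zeta / 10)%R by case/andP: z01 => /ltW.
apply: (@le_trans _ _ (((zeta / 10) `^ tail_exponent m) `^ (tail_exponent m)^-1)%R).
  by apply: ge0_ler_powR; rewrite ?nnegrE ?invr_ge0 ?powR_ge0// ltW.
by rewrite -powRrM divff ?gt_eqF// powRr1.
Qed.

(** The part weighted by [1 - k] is at most [2 * (zeta / 10) + 2 * c ^+ 2 * (1 - A)], the first term
    by Hölder. Since [1 - A <= zeta / 10 < 1 / 20], the mass [A] exceeds [19 / 20] and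
    [c ^+ 2 <= 20 / 19]. The sum is [(78 / 190) * zeta] at most, below [zeta / 2]. *)
Lemma variance_le_localized :
  \int[P]_x (k x)%:E = A%:E ->
  (1 - (zeta / 10) `^ tail_exponent m <= A)%R ->
  (A * c ^+ 2)%:E <= \int[P]_x (f x ^+ 2 * k x)%:E ->
  'V_P[f] <= \int[P]_x ((f x - c) ^+ 2 * k x)%:E + (zeta / 2)%:E.
Proof.
move=> kA A_ge cA.
have k0 x : (0 <= k x)%R by case/andP: (k01 x).
have k1 x : (k x <= 1)%R by case/andP: (k01 x).
have h01 x : (0 <= 1 - k x <= 1)%R.
  by apply/andP; split; [rewrite subr_ge0|rewrite gerBl].
have h0 x : (0 <= 1 - k x)%R by case/andP: (h01 x).
have mh : measurable_fun [set: T] (fun x => 1 - k x)%R by exact: measurable_funB.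
have mfc : measurable_fun [set: T] (fun x => (f x - c) ^+ 2)%R.
  by apply: measurable_funX; exact: measurable_funB.
have mf2 : measurable_fun [set: T] (fun x => f x ^+ 2)%R by exact: measurable_funX.
have hA : \int[P]_x (1 - k x)%:E = (1 - A)%:E.
  have : \int[P]_x (1 - k x)%:E + \int[P]_x (k x)%:E = 1.
    rewrite -ge0_integralD//; last 4 first.
    - by move=> x _; rewrite lee_fin.
    - exact/measurable_EFinP.
    - by move=> x _; rewrite lee_fin.
    - exact/measurable_EFinP.
    under eq_integral do rewrite -EFinD subrK.
    by rewrite integral_cst//= probability_setT mul1e.
  rewrite kA; case: (\int[P]_x (1 - k x)%:E) => [r|//|//].
  by rewrite -EFinD => -[<-]; rewrite addrK.
have e0 : (0 <= 1 - A)%R.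
  by rewrite -lee_fin -hA; apply: integral_ge0 => x _; rewrite lee_fin.
have ez : (1 - A <= (zeta / 10) `^ tail_exponent m)%R by move: A_ge; lra.
have ez1 : (1 - A <= zeta / 10)%R.
  by apply: (le_trans ez); rewrite ge1r_powR.
have A0 : (0 < A)%R by move: ez1 zeta_lt; lra.
have fh : \int[P]_x (f x ^+ 2 * (1 - k x))%:E <= (zeta / 10)%:E.
  apply: (le_trans (hoelder_weighted_square mf mh h01 m_gt2 f1)).
  by rewrite hA poweR_EFin lee_fin powR_te_inv.
(* The same Hölder bound with weight [k] gives a power of [A <= 1]; it controls [A * c ^+ 2]. *)
have fk : \int[P]_x (f x ^+ 2 * k x)%:E <= 1.
  apply: (le_trans (hoelder_weighted_square mf mk k01 m_gt2 f1)).
  have p1 : (1 = 1 `^ (tail_exponent m)^-1 :> R)%R by rewrite powR1.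
  rewrite kA poweR_EFin lee_fin [leRHS]p1.
  have te0 : (0 <= (tail_exponent m)^-1)%R.
    by rewrite invr_ge0 (le_trans _ te_ge1).
  by apply: ge0_ler_powR => //; rewrite ?nnegrE ?(ltW A0)//; move: e0; lra.
have Ac : (A * c ^+ 2 <= 1)%R by rewrite -lee_fin (le_trans cA).
have c20 : (0 <= c ^+ 2)%R by exact: sqr_ge0.
have c220 : (0 <= 2 * c ^+ 2)%R by exact: mulr_ge0.
have f20 x : (0 <= f x ^+ 2)%R by exact: sqr_ge0.
have fc20 x : (0 <= (f x - c) ^+ 2)%R by exact: sqr_ge0.
apply: (le_trans (variance_le_sqr_shift c)).
apply: (@le_trans _ _ (\int[P]_x (((f x - c) ^+ 2 * k x)%:E +
    (2%:E * (f x ^+ 2 * (1 - k x))%:E + (2 * c ^+ 2)%:E * (1 - k x)%:E)))).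
  apply: ge0_le_integral => //.
  - by move=> x _; rewrite lee_fin sqr_ge0.
  - exact/measurable_EFinP.
  - apply: emeasurable_funD.
      by apply/measurable_EFinP; exact: measurable_funM.
    apply: emeasurable_funD; apply: emeasurable_funM => //; apply/measurable_EFinP => //.
    exact: measurable_funM.
  - move=> x _; rewrite -!EFinM -!EFinD lee_fin.
    (* The slack of the pointwise bound is exactly [(1 - k x) * (f x + c) ^+ 2]. *)
    have kx := k1 x; have : (0 <= (1 - k x) * (f x + c) ^+ 2)%R.
      by rewrite mulr_ge0 ?sqr_ge0//.
    nra.
rewrite ge0_integralD//; last 4 first.
- by move=> x _; rewrite lee_fin mulr_ge0.
- by apply/measurable_EFinP; exact: measurable_funM.
- move=> x _; rewrite -!EFinM lee_fin; apply: addr_ge0; last exact: mulr_ge0.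
  by apply: mulr_ge0 => //; exact: mulr_ge0.
- apply: emeasurable_funD; apply: emeasurable_funM => //; apply/measurable_EFinP => //.
  exact: measurable_funM.
apply: leeD2l; rewrite ge0_integralD//; last 4 first.
- by move=> x _; rewrite -EFinM lee_fin mulr_ge0// mulr_ge0.
- by apply: emeasurable_funM => //; apply/measurable_EFinP; exact: measurable_funM.
- by move=> x _; rewrite -EFinM lee_fin mulr_ge0.
- by apply: emeasurable_funM => //; apply/measurable_EFinP.
rewrite ge0_integralZl//; last 2 first.
- by apply/measurable_EFinP; exact: measurable_funM.
- by move=> x _; rewrite lee_fin mulr_ge0.
rewrite ge0_integralZl//; last 2 first.
- exact/measurable_EFinP.
- by move=> x _; rewrite lee_fin.
rewrite hA; apply: (@le_trans _ _ (2%:E * (zeta / 10)%:E + (2 * c ^+ 2)%:E * (1 - A)%:E)).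
  by apply: leeD2r; rewrite lee_pmul2l.
rewrite -!EFinM -EFinD lee_fin.
have c2 : (c ^+ 2 <= 20 / 19)%R.
  have : (19 / 20 * c ^+ 2 <= A * c ^+ 2)%R.
    by rewrite ler_wpM2r ?c20; move: ez1 zeta_lt; lra.
  by move: Ac; lra.
have : (c ^+ 2 * (1 - A) <= 20 / 19 * (zeta / 10))%R.
  by apply: ler_pM => //; rewrite sqr_ge0.
by lra.
Qed.

End variance_localization.

(** * Dirichlet forms and spectral gaps *)

Section restricted_gap.
Context d (X : measurableType d) (R : realType).

(** Product form of the infimum, which also covers a vanishing denominator: there the left side is 0
    even if the gap is [+oo]. *)
Lemma spec_gap_on_local_form (X0 : set X) (mu : probability X R)
    (P : R.-pker X ~> X) (f : X -> R) :
  measurable_fun [set: X] f -> local_form X0 mu (fun=> mu) f < +oo ->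
  spec_gap_on X0 mu P * local_form X0 mu (fun=> mu) f <= local_form X0 mu P f.
Proof.
move=> mf Voo.
have lf0 Q : 0 <= local_form X0 mu Q f.
  by apply: integral_ge0 => x _; apply: integral_ge0 => y _; rewrite lee_fin sqr_ge0.
have [V0|V0] := eqVneq (local_form X0 mu (fun=> mu) f) 0.
  by rewrite V0 mule0.
have Vgt0 : 0 < local_form X0 mu (fun=> mu) f by rewrite lt_def V0 lf0.
have : spec_gap_on X0 mu P <= local_form X0 mu P f / local_form X0 mu (fun=> mu) f.
  by apply: ereal_inf_lbound; exists f => //; split => //; rewrite Vgt0.
case: (local_form X0 mu (fun=> mu) f) Vgt0 Voo => [r|//|//].
by rewrite lte_fin => r0 _; rewrite inve_EFin// lee_pdivlMr.
Qed.

Lemma spec_gap_on_ge0 (X0 : set X) (mu : probability X R) (P : R.-pker X ~> X) :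
  0 <= spec_gap_on X0 mu P.
Proof.
apply: le_ereal_inf_tmp => _ [f [mf /andP[V0 Voo]] <-].
have lf0 : 0 <= local_form X0 mu P f.
  by apply: integral_ge0 => x _; apply: integral_ge0 => y _; rewrite lee_fin sqr_ge0.
case: (local_form X0 mu (fun=> mu) f) V0 Voo => [r|//|//].
by rewrite lte_fin => r0 _; rewrite inve_EFin// mule_ge0// lee_fin invr_ge0 ltW.
Qed.

Variables (mu : probability X R) (P : R.-pker X ~> X) (f : X -> R) (B : set X).
Hypotheses (mf : measurable_fun [set: X] f) (mB : measurable B).

Let measurable_sqr_diff :
  measurable_fun [set: X * X] (fun z : X * X => ((f z.2 - f z.1) ^+ 2)%R).
Proof.
apply: measurable_funX; apply: measurable_funB.
  exact: (measurableT_comp mf measurable_snd).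
exact: (measurableT_comp mf measurable_fst).
Qed.

Lemma measurable_inner_form :
  measurable_fun [set: X] (fun x => \int[P x]_y ((f y - f x) ^+ 2)%:E).
Proof.
apply: (@measurable_fun_integral_finite_kernel _ _ X X R
  (fun z : X * X => ((f z.2 - f z.1) ^+ 2)%:E) P).
  by move=> z; rewrite lee_fin sqr_ge0.
exact/measurable_EFinP.
Qed.

Lemma local_form_le :
  local_form B mu P f <= \int[mu]_x \int[P x]_y ((f y - f x) ^+ 2)%:E.
Proof.
have sq0 (x y : X) : 0 <= ((f y - f x) ^+ 2)%:E by rewrite lee_fin sqr_ge0.
have msq (x : X) : measurable_fun [set: X] (fun y => ((f y - f x) ^+ 2)%:E).
  by apply/measurable_EFinP/measurable_funX; exact: measurable_funB.
apply: (@le_trans _ _ (\int[mu]_(x in B) \int[P x]_y ((f y - f x) ^+ 2)%:E)).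
  apply: ge0_le_integral => //.
  - by move=> x _; exact: integral_ge0.
  - apply: measurable_funTS.
    (* An indicator replaces the restriction to [B], so that measurability of kernel integrals over
       the whole space applies. *)
    under eq_fun do rewrite integral_mkcond/=.
    pose k (z : X * X) : \bar R := ((f z.2 - f z.1) ^+ 2 * \1_B z.2)%:E.
    rewrite (_ : (fun x => _) = fun x => \int[P x]_y k (x, y)); last first.
      apply/funext => x; apply: eq_integral => y _.
      by rewrite /k /= EFinM epatch_indic.
    apply: (@measurable_fun_integral_finite_kernel _ _ X X R k P).
      by move=> z; rewrite lee_fin mulr_ge0// sqr_ge0.
    apply/measurable_EFinP; apply: measurable_funM => //.
    have mi : measurable_fun [set: X] (\1_B : X -> R) by [].
    exact: (measurableT_comp mi (@measurable_snd _ _ X X)).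
  - exact/measurable_funTS/measurable_inner_form.
  - by move=> x _; apply: ge0_subset_integral.
apply: ge0_subset_integral => //; first exact: measurable_inner_form.
by move=> x _; exact: integral_ge0.
Qed.

End restricted_gap.

Section mixture_dirichlet.
Context d (X : measurableType d) (R : realType) (I : finType).
Variables (mu : {measure set X -> \bar R}) (p : I -> X -> R).
Hypothesis I_gt0 : (0 < #|I|)%N.
Hypothesis hp : forall i, normalizable mu (p i).
Variable K_ : I -> R.-pker X ~> X.

(** The inner integral is linear in the kernel, with weights [cond_index]; disintegration then turns
    the outer integral into integrals under the components. *)
Lemma dirichlet_form_mixture (f : X -> R) : measurable_fun [set: X] f ->
  dirichlet_form (mixture I_gt0 hp) (mixture_of_kernels I_gt0 hp K_) f =
  2^-1%:E * \sum_i index_prob mu p i *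
    \int[component hp i]_x \int[K_ i x]_y ((f y - f x) ^+ 2)%:E.
Proof.
move=> mf; rewrite /dirichlet_form -(integral_mixture_cond I_gt0 hp); last 2 first.
- by move=> i x; apply: integral_ge0 => y _; rewrite lee_fin sqr_ge0.
- by move=> i; exact: measurable_inner_form.
congr (_ * _); apply: eq_integral => x _.
rewrite ge0_integral_mixture_kernel//.
  by move=> y; rewrite lee_fin sqr_ge0.
by apply/measurable_EFinP/measurable_funX; exact: measurable_funB.
Qed.

End mixture_dirichlet.

(** * Lower bound on the zeta-spectral gap of the mixture *)

Section mixture_gap.
Context d (X : measurableType d) (R : realType) (I : finType).
Variables (mu : {measure set X -> \bar R}) (p : I -> X -> R).
Hypothesis I_gt0 : (0 < #|I|)%N.
Hypothesis hp : forall i, normalizable mu (p i).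

Local Notation P := (mixture I_gt0 hp).
Local Notation Q := (component hp).
Local Notation al := (index_weight mu p).

(** The weight multiplying [phi x] is the conditional probability, given [x], of the cylinder set.
    Disintegration applies once indices outside [I0] carry the empty set. *)
Lemma integral_mixture_cylinders (I0 : {set I}) (B : I -> set X) (phi : X -> R) :
  (forall i, measurable (B i)) -> (forall x, (0 <= phi x)%R) ->
  measurable_fun [set: X] phi ->
  \int[P]_x (phi x * \sum_(i in I0) cond_index p i x * \1_(B i) x)%:E =
  \sum_(i in I0) index_prob mu p i * \int[Q i]_(x in B i) (phi x)%:E.
Proof.
move=> mB phi0 mphi.
pose g i x : \bar R := (phi x * \1_(if i \in I0 then B i else set0) x)%:E.
have mB' i : measurable (if i \in I0 then B i else set0) by case: ifP.
transitivity (\int[P]_x (\sum_i (cond_index p i x)%:E * g i x)).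
  apply: eq_integral => x _; rewrite mulr_sumr big_mkcond/= -sumEFin.
  apply: eq_bigr => i _; rewrite /g -EFinM; case: ifP => iI.
    by congr EFin; ring.
  by rewrite indicE in_set0 !mulr0.
rewrite (integral_mixture_cond I_gt0 hp); last 2 first.
- by move=> i x; rewrite lee_fin mulr_ge0.
- by move=> i; apply/measurable_EFinP; exact: measurable_funM.
rewrite [RHS]big_mkcond/=; apply: eq_bigr => i _; rewrite /g.
case: ifP => iI.
  congr (_ * _); rewrite [RHS]integral_mkcond; apply: eq_integral => x _.
  by rewrite EFinM epatch_indic.
by rewrite integral0_eq ?mule0// => x _; rewrite indicE in_set0 mulr0.
Qed.

(** The integral under the mixture is a sum of nonnegative terms with positive weights, so an
    infinite term would make it infinite. *)
Lemma integrable_component (f : X -> R) : measurable_fun [set: X] f ->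
  P.-integrable [set: X] (fun x => (f x ^+ 2)%:E) ->
  forall i, (Q i).-integrable [set: X] (fun x => (f x ^+ 2)%:E).
Proof.
move=> mf /integrableP[mf2 foo] i; apply/integrableP; split => //.
move: foo; rewrite integral_mixture//; last exact: measurableT_comp.
rewrite (bigD1 i)//= index_probE//.
case: (\int[Q i]_x _) => [r _|H|//]; first by rewrite ltry.
move: H; rewrite gt0_muley ?lte_fin ?index_weight_gt0// addye//.
rewrite gt_eqF// (lt_le_trans ltNy0)// sume_ge0// => j _.
rewrite index_probE// mule_ge0 ?lee_fin ?(ltW (index_weight_gt0 _ _ _))//.
exact: integral_ge0.
Qed.

Variables (K_ : I -> R.-pker X ~> X) (m : \bar R).
Hypothesis m_gt2 : 2%:E < m.
Variables (I0 : {set I}) (B : I -> set X).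
Hypotheses (B_meas : forall i, measurable (B i)) (B_pos : forall i, 0 < Q i (B i)).
Variables (kappa : R) (e : rel I).
Hypotheses (kappa_gt0 : (0 < kappa)%R) (graph_e : simple_graph_on I0 e).
Hypothesis edge_overlap : forall i j, e i j ->
  kappa%:E <= \int[mu]_(x in B i `&` B j)
    mine ((component_density mu p i x)%:E / Q i (B i))
         ((component_density mu p j x)%:E / Q j (B j)).
Hypotheses (diam_ge1 : 1 <= diameter R I0 e) (diam_lty : diameter R I0 e < +oo).
Variable zeta : R.
Hypotheses (zeta_gt0 : (0 < zeta)%R) (zeta_lt : (zeta < 1 / 2)%R).
Hypothesis mass_B : (1 - (zeta / 10) `^ tail_exponent m)%:E <=
  joint_prob mu p (\bigcup_(i in [set` I0]) ([set i] `*` B i)).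

Let b i := fine (Q i (B i)).

Let bE i : Q i (B i) = (b i)%:E.
Proof. by rewrite fineK// fin_num_measure. Qed.

Let b01 i : (0 < b i <= 1)%R.
Proof. by rewrite -!lte_fin -lee_fin -bE B_pos probability_le1. Qed.

Section test_function.
Variable f : X -> R.
Hypotheses (fL2 : f \in Lfun P 2%:E) (f1 : 'N[P]_m[EFin \o f] = 1).

Let mf : measurable_fun [set: X] f.
Proof. by move: fL2; rewrite inE => /andP[]; rewrite inE. Qed.

Let if2 i : (Q i).-integrable [set: X] (fun x => (f x ^+ 2)%:E).
Proof. by apply: integrable_component => //; exact: Lfun2_integrable_sqr. Qed.

Let lm i := local_mean (Q i) (B i) f.
Let lv i := local_var (Q i) (B i) f.

Let lv_ge0 i : (0 <= lv i)%R. Proof. exact: local_var_ge0. Qed.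

(** Localization bounds ['V_P[f] - zeta / 2] by the squared deviation from [c] on the cylinder set,
    which the Poincaré inequality on the graph bounds by local variances. *)
Lemma variance_le_sum_local_var (D : R) : diameter R I0 e = D%:E ->
  (kappa / (2 * D))%:E * ('V_P[f] - (zeta / 2)%:E) <= (\sum_(i in I0) lv i)%:E.
Proof.
move=> DE.
have D1 : (1 <= D)%R by rewrite -lee_fin -DE.
have [i1 [j1 e1]] := diameter_edge diam_ge1 diam_lty.
have cd0 := component_density_ge0 hp.
have mcd := measurable_component_density hp.
have QE i := @component_densityE _ _ _ _ _ _ hp i.
have kappa_le1 : (kappa <= 1)%R.
  exact: (overlap_le1 (cd0 i1) (mcd i1) (cd0 j1) (mcd j1) (@QE i1)
    (B_meas i1) (B_pos i1) (B_meas j1) (B_pos j1) (edge_overlap e1)).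
(* [a i] is the joint mass of the cylinder over [i], so [A] below is the mass of the cylinder set
   and [c] the mean of [f] on it. *)
pose a i := (al i * b i)%R.
have a_gt0 i : (0 < a i)%R.
  by rewrite mulr_gt0 ?(index_weight_gt0 I_gt0 hp)//; case/andP: (b01 i).
pose A := (\sum_(i in I0) a i)%R.
have A_gt0 : (0 < A)%R.
  have /andP[iI _] := graph_sub graph_e e1.
  by rewrite /A (bigD1 i1)//= ltr_pwDl// sumr_ge0// => i _; exact: ltW.
have A_le1 : (A <= 1)%R.
  rewrite -(index_weight_sum1 I_gt0 hp) /A big_mkcond/=; apply: ler_sum => i _.
  have al0 := ltW (index_weight_gt0 I_gt0 hp i).
  case: ifP => _ //; rewrite ler_piMr//.
  by case/andP: (b01 i).
pose c := ((\sum_(i in I0) a i * lm i) / A)%R.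
pose k x := (\sum_(i in I0) cond_index p i x * \1_(B i) x)%R.
have [mw w0 w1] := weights_cond_index I_gt0 hp.
have mk : measurable_fun [set: X] k.
  rewrite /k; under eq_fun do rewrite big_mkcond/=.
  apply: measurable_sum => i.
  by case: (i \in I0) => //; exact: measurable_funM.
have k01 x : (0 <= k x <= 1)%R.
  apply/andP; split; first by apply: sumr_ge0 => i _; rewrite mulr_ge0.
  rewrite -(w1 x) /k big_mkcond/=; apply: ler_sum => i _.
  by case: ifP => // _; rewrite ler_piMr// indicE; case: (_ \in _).
have cylE (phi : X -> R) : (forall x, (0 <= phi x)%R) -> measurable_fun [set: X] phi ->
    \int[P]_x (phi x * k x)%:E =
    \sum_(i in I0) (al i)%:E * \int[Q i]_(x in B i) (phi x)%:E.
  move=> phi0 mphi; rewrite integral_mixture_cylinders//.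
  by apply: eq_bigr => i _; rewrite (index_probE I_gt0 hp).
have kA : \int[P]_x (k x)%:E = A%:E.
  have := cylE (cst 1%R) (fun=> ler01) (measurable_cst _).
  under eq_integral do rewrite /= mul1r.
  move=> ->; rewrite /A -sumEFin; apply: eq_bigr => i _.
  rewrite -[X in _ * X]/(\int[Q i]_(x in B i) (cst 1 x)).
  by rewrite integral_cst// mul1e EFinM -bE.
have sqrE y : \int[P]_x ((f x - y) ^+ 2 * k x)%:E =
    (\sum_(i in I0) a i * (lv i + (lm i - y) ^+ 2))%:E.
  rewrite cylE; last 2 first.
  - by move=> x; exact: sqr_ge0.
  - by apply: measurable_funX; exact: measurable_funB.
  rewrite -sumEFin; apply: eq_bigr => i _.
  by rewrite integral_sqr_shift// -EFinM mulrA.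
have A_ge : (1 - (zeta / 10) `^ tail_exponent m <= A)%R.
  rewrite -lee_fin (le_trans mass_B)// (joint_prob_cylinders I_gt0 hp) /A -sumEFin.
  by apply: lee_sum => i _; rewrite (index_probE I_gt0 hp) bE.
(* Jensen's inequality for the local means, after which the local variances are added. *)
have cA : (A * c ^+ 2)%:E <= \int[P]_x (f x ^+ 2 * k x)%:E.
  have := sqrE 0%R; under eq_integral do rewrite subr0.
  move=> ->; rewrite lee_fin.
  apply: (@le_trans _ _ (\sum_(i in I0) a i * lm i ^+ 2)%R).
    rewrite -subr_ge0 -(sum_sqr_dev_mean _ (lt0r_neq0 A_gt0)).
    by apply: sumr_ge0 => i _; rewrite mulr_ge0 ?sqr_ge0// ltW.
  by apply: ler_sum => i _; rewrite subr0 ler_pM2l// lerDr.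
have := variance_le_localized fL2 mk k01 m_gt2 f1 zeta_gt0 zeta_lt kA A_ge cA.
(* The variance of an [L^2] function is finite, so the rest is an inequality between reals. *)
rewrite sqrE -[X in _ -> _ * (X - _) <= _]fineK ?variance_fin_num//.
rewrite -[X in X <= _]fineK ?variance_fin_num//.
move: (fine 'V_P[f]) => V; rewrite -!EFinD -EFinM !lee_fin => HV.
have edge i j : e i j -> (kappa * (lm i - lm j) ^+ 2 <= 2 * (lv i + lv j))%R.
  move=> eij.
  exact: (overlap_local_mean mf (cd0 i) (mcd i) (cd0 j) (mcd j) (@QE i) (@QE j)
    (B_meas i) (B_pos i) (B_meas j) (B_pos j) (edge_overlap eij) (if2 i) (if2 j)).
have kk : (0 < kappa <= 1)%R by rewrite kappa_gt0.
have AA : (0 < A <= 1)%R by rewrite A_gt0.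
have := diameter_poincare graph_e lv_ge0 (fun i => ltW (a_gt0 i)) AA kk D1 DE
  edge (erefl c).
set W := (\sum_(i in I0) _)%R in HV *; set S := (\sum_(i in I0) _)%R => HW.
have D0 : (0 < 2 * D)%R by rewrite mulr_gt0// (lt_le_trans _ D1).
rewrite mulrAC ler_pdivrMr// (mulrC S); apply: (le_trans _ HW).
by rewrite ler_pM2l// lerBlDr.
Qed.

(** Indices outside [I0] and pairs outside the [B i] are dropped, and each restricted gap turns a
    local form into [2 * b i ^+ 2 * lv i]; this 2 cancels the half in the Dirichlet form. [r] and
    [G] stand for the two minima, and [G] is extended because a restricted gap may be [+oo]. *)
Lemma dirichlet_form_ge_sum_local_var (r : R) (G : \bar R) :
  (forall i, i \in I0 -> (r <= b i ^+ 2)%R) -> (0 <= r)%R -> 0 <= G ->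
  (forall i, i \in I0 -> G <= index_prob mu p i * spec_gap_on (B i) (Q i) (K_ i)) ->
  G * (r * \sum_(i in I0) lv i)%:E <=
  dirichlet_form P (mixture_of_kernels I_gt0 hp K_) f.
Proof.
move=> rb r0 G0 Gle; rewrite dirichlet_form_mixture// lee_pdivlMl//.
apply: (@le_trans _ _ (\sum_(i in I0) index_prob mu p i *
    \int[Q i]_x \int[K_ i x]_y ((f y - f x) ^+ 2)%:E)); last first.
  rewrite [leLHS]big_mkcond/=; apply: lee_sum => i _; case: ifP => // _.
  rewrite (index_probE I_gt0 hp) mule_ge0//.
    by rewrite lee_fin ltW// (index_weight_gt0 I_gt0 hp).
  by apply: integral_ge0 => x _; apply: integral_ge0 => y _; rewrite lee_fin sqr_ge0.
rewrite muleCA -EFinM mulr_sumr mulr_sumr -sumEFin ge0_sume_distrr; last first.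
  by move=> i _; rewrite lee_fin mulr_ge0// mulr_ge0.
apply: lee_sum => i iI.
have lfE := local_form_prob (B_meas i) mf (if2 i) (B_pos i).
have al0 : 0 <= index_prob mu p i.
  by rewrite (index_probE I_gt0 hp) lee_fin ltW// (index_weight_gt0 I_gt0 hp).
apply: (@le_trans _ _ (index_prob mu p i *
    (spec_gap_on (B i) (Q i) (K_ i) * local_form (B i) (Q i) (fun=> Q i) f))).
  rewrite lfE muleA; apply: lee_pmul => //.
  - by rewrite lee_fin mulr_ge0// mulr_ge0.
  - exact: Gle.
  - by rewrite lee_fin mulrA ler_wpM2r// ler_pM2l// rb.
apply: lee_wpmul2l => //.
apply: le_trans (local_form_le _ _ mf (B_meas i)).
by apply: spec_gap_on_local_form => //; rewrite lfE ltry.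
Qed.

End test_function.

Lemma spec_gap_zeta_mixture_ge :
  kappa%:E / (2%:E * diameter R I0 e)
    * \big[mine/+oo]_(i in I0) (Q i (B i) ^+ 2)
    * \big[mine/+oo]_(i in I0)
        (index_prob mu p i * spec_gap_on (B i) (Q i) (K_ i))
  <= spec_gap_zeta (fun f => 'N[P]_m[EFin \o f]) zeta
       P (mixture_of_kernels I_gt0 hp K_).
Proof.
have [D DE] : exists D, diameter R I0 e = D%:E.
  by case: (diameter R I0 e) diam_ge1 diam_lty => [r|//|//]; exists r.
have D1 : (1 <= D)%R by rewrite -lee_fin -DE.
have D0 : (0 < 2 * D)%R by rewrite mulr_gt0// (lt_le_trans _ D1).
have [i1 [j1 e1]] := diameter_edge diam_ge1 diam_lty.
have /andP[iI _] := graph_sub graph_e e1.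
set M := \big[mine/+oo]_(i in I0) (Q i (B i) ^+ 2).
set G := \big[mine/+oo]_(i in I0) _.
have M0 : 0 <= M.
  by apply: le_bigmin => // i _; rewrite bE -EFin_expe lee_fin sqr_ge0.
have G0 : 0 <= G.
  apply: le_bigmin => // i _; rewrite mule_ge0 ?spec_gap_on_ge0//.
  by rewrite (index_probE I_gt0 hp) lee_fin ltW// (index_weight_gt0 I_gt0 hp).
have Mle i : i \in I0 -> M <= (b i ^+ 2)%:E.
  by move=> iI0; rewrite EFin_expe -bE; exact: bigmin_le_cond.
have Gle i : i \in I0 -> G <= index_prob mu p i * spec_gap_on (B i) (Q i) (K_ i).
  by move=> iI0; exact: bigmin_le_cond.
(* The minimum is finite because the edge found above makes [I0] nonempty. *)
have [r ME] : exists r, M = r%:E.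
  case: M M0 Mle => [r _ _|_ /(_ _ iI)|//]; first by exists r.
  by rewrite leye_eq.
have r0 : (0 <= r)%R by rewrite -lee_fin -ME.
apply: le_ereal_inf_tmp => _ [f [fL2 fV f1] <-].
have SV := variance_le_sum_local_var fL2 f1 DE.
have rb i : i \in I0 -> (r <= b i ^+ 2)%R.
  by move=> iI0; rewrite -lee_fin -ME Mle.
have ES := dirichlet_form_ge_sum_local_var fL2 rb r0 G0 Gle.
rewrite DE ME -EFinM inve_EFin//.
move: SV fV; rewrite -['V_P[f]]fineK ?variance_fin_num//.
move: (fine 'V_P[f]) => V; rewrite -EFinB -!EFinM lee_fin lte_fin => SV zV.
(* A variance above [zeta] makes the denominator positive. *)
have t0 : (0 < V - zeta / 2)%R by move: zV zeta_gt0; lra.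
rewrite inve_EFin// lee_pdivlMr//; apply: le_trans ES.
(* [G], possibly [+oo], is isolated as a common nonnegative factor; what remains is real. *)
rewrite [_ * G]muleC -muleA -EFinM; apply: lee_wpmul2l => //.
rewrite lee_fin mulrAC [leRHS]mulrC.
by rewrite ler_wpM2r.
Qed.

End mixture_gap.

(** * The bound under hypotheses on the sets indexed by [I0] only *)

Unset Implicit Arguments.

Theorem theorem3 (R : realType) (I : finType) (I_gt0 : (0 < #|I|)%N)
    (X : ptopologicalType) (polishX : polish R X)
    (mu : {sigma_finite_measure set (borel X) -> \bar R})
    (p : I -> borel X -> R) (hp : forall i, normalizable mu (p i))
    (K_ : I -> R.-pker (borel X) ~> (borel X))
    (K_rev : forall i, reversible (component hp i) (K_ i))
    (K_erg : forall i, ergodic (component hp i) (K_ i))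
    (m : \bar R) (m_gt2 : 2%:E < m)
    (I0 : {set I}) (B : I -> set (borel X))
    (B_meas : forall i, i \in I0 -> measurable (B i))
    (B_neq0 : forall i, i \in I0 -> B i !=set0)
    (B_pos : forall i, i \in I0 -> 0 < component hp i (B i))
    (kappa : R) (kappa_gt0 : (0 < kappa)%R)
    (e : rel I) (graph_e : simple_graph_on I0 e)
    (edge_overlap : forall i j, e i j ->
       kappa%:E <= \int[mu]_(x in B i `&` B j)
         mine ((component_density mu p i x)%:E / component hp i (B i))
              ((component_density mu p j x)%:E / component hp j (B j)))
    (diam_ge1 : 1 <= diameter R I0 e) (diam_lty : diameter R I0 e < +oo)
    (zeta : R) (zeta_gt0 : (0 < zeta)%R) (zeta_lt : (zeta < 1 / 2)%R)
    (mass_B : (1 - (zeta / 10) `^ tail_exponent m)%:E <=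
       joint_prob mu p (\bigcup_(i in [set` I0]) ([set i] `*` B i))) :
  kappa%:E / (2%:E * diameter R I0 e)
    * \big[mine/+oo]_(i in I0) (component hp i (B i) ^+ 2)
    * \big[mine/+oo]_(i in I0)
        (index_prob mu p i * spec_gap_on (B i) (component hp i) (K_ i))
  <= spec_gap_zeta (fun f => 'N[mixture I_gt0 hp]_m[EFin \o f]) zeta
       (mixture I_gt0 hp) (mixture_of_kernels I_gt0 hp K_).
Proof.
(* [B] is arbitrary outside [I0]. *)
pose B' i := if i \in I0 then B i else [set: borel X].
have B'E i : i \in I0 -> B i = B' i by rewrite /B' => ->.
have B'_meas i : measurable (B' i) by rewrite /B'; case: ifP => // /B_meas.
have B'_pos i : 0 < component hp i (B' i).
  by rewrite /B'; case: ifP => [/B_pos//|_]; rewrite probability_setT.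
have overlap' i j : e i j -> kappa%:E <= \int[mu]_(x in B' i `&` B' j)
    mine ((component_density mu p i x)%:E / component hp i (B' i))
         ((component_density mu p j x)%:E / component hp j (B' j)).
  move=> eij; have /andP[iI jI] := graph_sub graph_e eij.
  by rewrite -!B'E//; exact: edge_overlap.
rewrite (eq_bigr (fun i => component hp i (B' i) ^+ 2)); last first.
  by move=> i /B'E ->.
rewrite [X in _ * X <= _](eq_bigr (fun i =>
    index_prob mu p i * spec_gap_on (B' i) (component hp i) (K_ i))); last first.
  by move=> i /B'E ->.
apply: (spec_gap_zeta_mixture_ge I_gt0 K_ m_gt2 B'_meas B'_pos kappa_gt0
  graph_e overlap' diam_ge1 diam_lty zeta_gt0 zeta_lt).
suff <- : \bigcup_(i in [set` I0]) ([set i] `*` B i) =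
  \bigcup_(i in [set` I0]) ([set i] `*` B' i) by [].
by apply: eq_bigcupr => i iI; rewrite -B'E.
Qed.
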